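(* Let $n$ and $m$ be integers with $n\geq 6$ and $5\leq m\leq 2n-3$. Then $H_{n,m}$ is a $3$-uniformly most reliable two-terminal graph ($3$-UMRTTG) in $T_{n,m}$, and it is the only one (every $3$-UMRTTG in $T_{n,m}$ is isomorphic to $H_{n,m}$ as a two-terminal graph).
   Context: All graphs are finite, simple and undirected. A two-terminal graph is a graph $G$ together with two distinguished vertices $s,t$ (the terminals). Two two-terminal graphs are isomorphic if there is a graph isomorphism between them mapping the set of terminals onto the set of terminals. $T_{n,m}$ denotes the set of all pairwise nonisomorphic two-terminal graphs with $n$ vertices and $m$ edges. For a positive integer $d$, a $d$-pathset of a two-terminal graph $G$ is a spanning subgraph of $G$ containing a path of length (number of edges) at most $d$ joining $s$ and $t$. For $\rho\in[0,1]$, $R_G^d(\rho)$ is the probability that the random spanning subgraph obtained from $G$ by deleting each edge independently with probability $\rho$ is a $d$-pathset. A graph $G\in T_{n,m}$ is a $d$-UMRTTG if $R_G^d(\rho)\geq R_H^d(\rho)$ for every $H\in T_{n,m}$ and every $\rho\in[0,1]$. For integers $k\geq 3$ and $r\in\{0,1,\ldots,k-3\}$, $A_{k,r}$ is the two-terminal graph with vertex set $\{s,t,v_3,\ldots,v_k\}$, terminals $s,t$, and edge set $\{st\}\cup\{sv_i,v_it: 3\leq i\leq k\}\cup\{v_3v_{3+j}: 1\leq j\leq r\}$. For $n\geq 5$ and $5\leq m\leq 2n-3$, $H_{n,m}\in T_{n,m}$ is obtained from $A_{(m+2)/2,1}$ by adding $n-\frac{m+2}{2}$ isolated vertices when $m$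 is even, and from $A_{(m+3)/2,0}$ by adding $n-\frac{m+3}{2}$ isolated vertices when $m$ is odd. *)

(* Defs.v *)
From HB Require Import structures.
From mathcomp Require Import all_boot all_order all_algebra all_fingroup.
From mathcomp Require Import boolp reals.
Set Implicit Arguments. Unset Strict Implicit. Unset Printing Implicit Defensive.
Import Order.TTheory GRing.Theory Num.Theory.

Record ttg (n : nat) := TTG {
  tedges : {set {set 'I_n}};
  tsrc : 'I_n;
  tdst : 'I_n }.

Definition ttg_wf n (G : ttg n) : bool :=
  (tsrc G != tdst G) && [forall e in tedges G, #|e| == 2].

Definition in_T n m (G : ttg n) : bool := ttg_wf G && (#|tedges G| == m).

Definition ttg_iso n (G H : ttg n) : Prop :=
  exists sigma : {perm 'I_n},
    (forall u v : 'I_n,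
        ([set u; v] \in tedges G) = ([set sigma u; sigma v] \in tedges H)) /\
    [set sigma (tsrc G); sigma (tdst G)] = [set tsrc H; tdst H].

Definition dpathset n (d : nat) (s t : 'I_n) (F : {set {set 'I_n}}) : Prop :=
  exists p : seq 'I_n,
    [/\ uniq (s :: p), last s p = t, size p <= d
      & path (fun x y => [set x; y] \in F) s p].

(* R_G^d(rho): probability that the random spanning subgraph, obtained by
   deleting each edge independently with probability rho, is a d-pathset *)
Definition reliab (R : realType) n (d : nat) (G : ttg n) (rho : R) : R :=
  (\sum_(F in powerset (tedges G) | `[< dpathset d (tsrc G) (tdst G) F >])
      (1 - rho) ^+ #|F| * rho ^+ (#|tedges G| - #|F|))%R.

Definition UMRTTG (R : realType) (d n m : nat) (G : ttg n) : Prop :=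
  in_T m G /\
  forall H : ttg n, in_T m H ->
    forall rho : R, (0 <= rho <= 1)%R -> (reliab d H rho <= reliab d G rho)%R.

(* H_{n,m}: labelling s = 0, t = 1, v_i = i - 1 (i = 3..k).
   A_{k,r} has edges st, s v_i, v_i t (3 <= i <= k), v_3 v_{3+j} (1 <= j <= r).
   m even: k = (m+2)/2, r = 1;  m odd: k = (m+3)/2, r = 0.
   Remaining vertices (labels k..n-1) are isolated. *)
Definition H_k (m : nat) : nat := if odd m then (m + 3)./2 else (m + 2)./2.
Definition H_r (m : nat) : nat := if odd m then 0 else 1.

Definition A_adj (k r : nat) (u v : nat) : bool :=
  [|| (u == 0) && (v == 1),
      (u == 0) && (2 <= v < k),
      (u == 1) && (2 <= v < k)
    | (u == 2) && (3 <= v < 3 + r)].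

Definition H_edges (n m : nat) : {set {set 'I_n}} :=
  [set e : {set 'I_n} | [exists u : 'I_n, exists v : 'I_n,
      (e == [set u; v]) &&
      (A_adj (H_k m) (H_r m) u v || A_adj (H_k m) (H_r m) v u)]].

(* H_{n,m} with terminals s, t (intended: val s = 0, val t = 1) *)
Definition H_graph (n m : nat) (s t : 'I_n) : ttg n := TTG (H_edges n m) s t.

(* Main.v *)
Require Import Defs.
From HB Require Import structures.
From mathcomp Require Import all_boot all_order all_algebra all_fingroup.
From mathcomp Require Import boolp reals.
From mathcomp Require Import ring lra zify.
Set Implicit Arguments. Unset Strict Implicit. Unset Printing Implicit Defensive.
Import Order.TTheory GRing.Theory Num.Theory.
Local Open Scope ring_scope.

(** Put p = 1 - rho, u = 1 - p^2 and g = 1 - 2 p^3 / (1 + p)^2. In a graph G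
    let A be the set of common neighbours of the terminals, O the set of
    vertices adjacent to exactly one terminal, and e the number of edges inside
    A. Paths of length at most 3 other than st use either two edges at a vertex
    of A, or an inner edge; charge an inner edge not inside A to an end in O,
    j(x) being the number of edges charged to x. The failure events are
    decreasing, so by Harris' inequality the unreliability of G is at least
      rho^[st is an edge] * P(A) * prod_{x in O} (rho + p u^j(x)),
    where P(A) is the probability that no path through A only survives.
    Conditioned on the absence of surviving paths of length 2, each vertex of A
    is a spin in {s, t, none}, and Griffiths' inequality for the signs together
    with Harris' inequality for the supports gives P(A) >= u^|A| g^e, with
    equality for e <= 1. With bnd(M) = u^(M/2) g^(M mod 2), which is
    submultiplicative, each factor dominates bnd of the number of edges it
    accounts for, so the unreliability is at least rho * bnd(m - 1), which is
    the value for H_{n,m}. All scalar inequalities are strict for 0 < p < 1,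
    and equality at rho = 1/2 determines the graph. *)

(** * Expectation over random subsets *)

Section Expectation.
Variables (R : realFieldType) (T : finType).
Implicit Types (q : R) (r : seq T) (f g : {set T} -> R) (F G : {set T}).

(** Mean of [f] over a random subset of [r] that keeps each entry independently with probability
    [q]. Conditioning on the head makes inductions on [r] compute; [Ex_sum] recovers the explicit
    weights when [r] is duplicate-free. *)
Fixpoint Ex q r f : R :=
  if r is x :: r' then (1 - q) * Ex q r' f + q * Ex q r' (fun F => f (x |: F))
  else f set0.

Lemma eq_Ex_in q r f g :
  (forall F, F \subset r -> f F = g F) -> Ex q r f = Ex q r g.
Proof.
elim: r f g => [|x r IH] f g fg /=; first by apply: fg; apply/subsetP => y; rewrite inE.
congr (_ * _ + _ * _); apply: IH => F /subsetP sF; apply: fg.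
  by apply/subsetP => y /sF; rewrite in_cons orbC => ->.
apply/subsetP => y; rewrite !inE => /orP[-> //|/sF ->]; exact: orbT.
Qed.

Lemma le_Ex_in q r f g : 0 <= q <= 1 ->
  (forall F, F \subset r -> f F <= g F) -> Ex q r f <= Ex q r g.
Proof.
move=> /andP[q0 q1]; elim: r f g => [|x r IH] f g fg /=.
  by apply: fg; apply/subsetP => y; rewrite inE.
apply: lerD; apply: ler_wpM2l => //; rewrite ?subr_ge0 //;
  apply: IH => F /subsetP sF; apply: fg; apply/subsetP => y.
  by move=> /sF; rewrite in_cons orbC => ->.
rewrite !inE => /orP[-> //|/sF ->]; exact: orbT.
Qed.

Lemma Ex_cst q r (c : R) : Ex q r (fun=> c) = c.
Proof. elim: r => //= x r ->; ring. Qed.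

Lemma ExZ q r (c : R) f : Ex q r (fun F => c * f F) = c * Ex q r f.
Proof. by elim: r f => //= x r IH f; rewrite !IH; ring. Qed.

Lemma ExD q r f g : Ex q r (fun F => f F + g F) = Ex q r f + Ex q r g.
Proof. by elim: r f g => //= x r IH f g; rewrite !IH; ring. Qed.

Lemma Ex_ge0 q r f : 0 <= q <= 1 -> (forall F, 0 <= f F) -> 0 <= Ex q r f.
Proof. by move=> hq hf; rewrite -(Ex_cst q r 0); apply: le_Ex_in. Qed.

Lemma Ex_cat q r1 r2 f :
  Ex q (r1 ++ r2) f = Ex q r1 (fun F => Ex q r2 (fun G => f (F :|: G))).
Proof.
elim: r1 f => [|x r1 IH] f /=; first by apply: eq_Ex_in => F _; rewrite set0U.
rewrite !IH; congr (_ + _ * _); apply: eq_Ex_in => F _.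
by apply: eq_Ex_in => G _; rewrite setUA.
Qed.

Lemma Ex_sum q r f : uniq r ->
  Ex q r f = \sum_(F in powerset [set x in r])
               q ^+ #|F| * (1 - q) ^+ (size r - #|F|) * f F.
Proof.
elim: r f => [|x r IH] f /=.
  move=> _; rewrite (_ : [set x in [::]] = set0); last by apply/setP=> y; rewrite !inE.
  by rewrite powerset0 big_set1 cards0 !expr0 !mul1r.
move=> /andP[xr ur]; rewrite !IH // [RHS](bigID (fun F => x \in F)) /= [RHS]addrC.
have sizer : #|[set x in r]| = size r by rewrite cardsE; apply/card_uniqP.
congr (_ + _).
- rewrite big_distrr /=; apply: eq_big => [F|F]; last first.
    rewrite powersetE => /subset_leq_card; rewrite sizer => cF.
    by rewrite subSn // exprS; ring.
  rewrite !powersetE; apply/idP/andP.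
    move=> /subsetP sF; split; last by apply/negP => /sF; rewrite inE; apply/negP.
    by apply/subsetP => y /sF; rewrite !inE orbC => ->.
  move=> [/subsetP sF xF]; apply/subsetP => y yF.
  by move: (sF _ yF); rewrite !inE => /orP[/eqP yx|//]; rewrite -yx yF in xF.
rewrite big_distrr /=.
rewrite [RHS](reindex_onto (fun F => x |: F) (fun F => F :\ x)) /=; last first.
  by move=> F /andP[_ xF]; rewrite setD1K.
apply: eq_big => [F|F].
  rewrite !powersetE; apply/idP/idP.
    move=> /subsetP sF; have xF : x \notin F by apply/negP => /sF; rewrite inE; apply/negP.
    rewrite setU11 andbT setU1K // eqxx andbT.
    by apply/subsetP => y; rewrite !inE => /orP[->//|/sF]; rewrite inE orbC => ->.
  move=> /andP[/andP[/subsetP sF _] /eqP eF]; apply/subsetP => y yF.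
  have : y \in x |: F by rewrite !inE yF orbT.
  move: (yF); rewrite -eF !inE => /andP[yx _]; rewrite (negbTE yx) /= => yF'.
  by have := sF y; rewrite !inE (negbTE yx) yF' => /(_ isT).
rewrite powersetE => /subsetP sF.
have xF : x \notin F by apply/negP => /sF; rewrite inE; apply/negP.
by rewrite cardsU1 xF add1n subSS exprS; ring.
Qed.

Lemma perm_Ex q r1 r2 f : uniq r1 -> perm_eq r1 r2 -> Ex q r1 f = Ex q r2 f.
Proof.
move=> u1 p12; have u2 : uniq r2 by rewrite -(perm_uniq p12).
rewrite !Ex_sum // (perm_size p12).
suff -> : [set x in r1] = [set x in r2] by [].
by apply/setP => x; rewrite !inE (perm_mem p12).
Qed.

(** With [x] and [y] moved to the front of the list, the integrand is constant in the remaining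
    elements. *)
Lemma Ex_pair q r (x y : T) (h : bool -> bool -> R) :
  uniq r -> x \in r -> y \in r -> x != y ->
  Ex q r (fun F => h (x \in F) (y \in F)) =
  (1 - q) * ((1 - q) * h false false + q * h false true) +
  q * ((1 - q) * h true false + q * h true true).
Proof.
move=> ur xr yr xy.
have p : perm_eq r (x :: y :: rem y (rem x r)).
  rewrite (permPl (perm_to_rem xr)) perm_cons; apply: perm_to_rem.
  by rewrite mem_rem_uniq // inE eq_sym xy.
rewrite (perm_Ex _ _ ur p) /=; set r' := rem y _.
have : uniq (x :: y :: r') by rewrite -(perm_uniq p).
rewrite /= inE negb_or => /and3P[/andP[_ xr'] yr' _].
have mE F (z : T) : z \notin r' -> F \subset r' -> (z \in F) = false.
  by move=> zr /subsetP sF; apply/negP => /sF; apply/negP.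
rewrite (@eq_Ex_in _ _ _ (fun=> h false false)); last first.
  by move=> F sF; rewrite !mE.
rewrite (@eq_Ex_in _ _ (fun F => _ (x \in y |: F) _) (fun=> h false true)); last first.
  by move=> F sF; rewrite !inE eqxx (negbTE xy) /= mE.
rewrite (@eq_Ex_in _ _ (fun F => _ (x \in x |: F) _) (fun=> h true false)); last first.
  by move=> F sF; rewrite !inE eqxx eq_sym (negbTE xy) /= mE.
rewrite (@eq_Ex_in _ _ (fun F => _ (x \in x |: (y |: F)) _) (fun=> h true true)); last first.
  by move=> F sF; rewrite !inE !eqxx orbT.
by rewrite !Ex_cst.
Qed.

(** Independence: each factor looks at one element only. Read from right to left, it replaces a
    factor [1 - q * c e] by an average over the presence of [e]. *)
Lemma Ex_prod q r (c : T -> R) : uniq r ->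
  Ex q r (fun F => \prod_(e <- r) (1 - (e \in F)%:R * c e)) =
  \prod_(e <- r) (1 - q * c e).
Proof.
elim: r => [|x r IH] /=; first by rewrite !big_nil.
move=> /andP[xr ur]; rewrite big_cons -IH // mulrBl mul1r.
rewrite (@eq_Ex_in _ _ _ (fun F => \prod_(e <- r) (1 - (e \in F)%:R * c e))); last first.
  move=> F /subsetP sF; rewrite big_cons.
  have -> : x \in F = false by apply/negP => /sF; apply/negP.
  by rewrite mul0r subr0 mul1r.
rewrite (@eq_Ex_in _ _ (fun F => \prod_(e <- x :: r) _)
  (fun F => (1 - c x) * \prod_(e <- r) (1 - (e \in F)%:R * c e))); last first.
  move=> F /subsetP sF; rewrite big_cons setU11 mul1r; congr (_ * _).
  apply: eq_big_seq => e er; rewrite !inE; case: eqP => // ex.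
  by rewrite -ex er in xr.
rewrite ExZ; ring.
Qed.

Definition antitone f := forall F G, F \subset G -> f G <= f F.

(* The step rests on E[fg] - E[f]E[g] = q(1-q)(f0-f1)(g0-g1) for one Bernoulli
   variable. *)
Lemma Harris q r f g : 0 <= q <= 1 -> antitone f -> antitone g ->
  Ex q r f * Ex q r g <= Ex q r (fun F => f F * g F).
Proof.
move=> hq; elim: r f g => [|x r IH] f g af ag //=.
have [q0 q1] := andP hq.
have a1 h : antitone h -> antitone (fun F => h (x |: F)).
  by move=> ah F G FG; apply: ah; apply: setUS.
have l h : antitone h -> Ex q r (fun F => h (x |: F)) <= Ex q r h.
  by move=> ah; apply: le_Ex_in => // F _; apply: ah; apply: subsetU1.
have := IH _ _ af ag; have := IH _ _ (a1 _ af) (a1 _ ag).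
move: (l _ af) (l _ ag).
set f0 := Ex q r f; set f1 := Ex q r _; set g0 := Ex q r g; set g1 := Ex q r _.
set fg1 := Ex q r _; set fg0 := Ex q r _ => lf lg h1 h0.
have : 0 <= q * (1 - q) * ((f0 - f1) * (g0 - g1)).
  by rewrite !mulr_ge0 ?subr_ge0.
have := ler_wpM2l q0 h1.
have q1' : 0 <= 1 - q by rewrite subr_ge0.
have := ler_wpM2l q1' h0.
nra.
Qed.

Lemma antitone_prod (I : eqType) (s : seq I) (f : I -> {set T} -> R) :
  (forall i F, i \in s -> 0 <= f i F) ->
  {in s, forall i, antitone (f i)} ->
  antitone (fun F => \prod_(i <- s) f i F).
Proof.
move=> f0 af F G FG; rewrite big_seq [leRHS]big_seq; apply: ler_prod => i si.
by rewrite f0 // af.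
Qed.

Lemma Harris_prod (I : eqType) q r (s : seq I) (f : I -> {set T} -> R) :
  0 <= q <= 1 ->
  (forall i F, i \in s -> 0 <= f i F) ->
  {in s, forall i, antitone (f i)} ->
  \prod_(i <- s) Ex q r (f i) <= Ex q r (fun F => \prod_(i <- s) f i F).
Proof.
move=> hq; elim: s => [|i s IH] f0 af.
  by rewrite big_nil (@eq_Ex_in _ _ _ (fun=> 1)) ?Ex_cst // => F _; rewrite big_nil.
rewrite big_cons [leRHS](@eq_Ex_in _ _ _ (fun F => f i F * \prod_(j <- s) f j F)); last first.
  by move=> F _; rewrite big_cons.
have f0' j F : j \in s -> 0 <= f j F by move=> js; apply: f0; rewrite inE js orbT.
have af' : {in s, forall i, antitone (f i)}.
  by move=> j js; apply: af; rewrite inE js orbT.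
apply: le_trans (Harris _ hq _ _); [|by apply: af; rewrite mem_head|exact: antitone_prod].
by apply: ler_wpM2l (IH f0' af'); apply: Ex_ge0 => // F; apply: f0; rewrite mem_head.
Qed.

End Expectation.

Lemma Ex_map (R : realFieldType) (T U : finType) (q : R) (phi : U -> T)
    (r : seq U) (f : {set T} -> R) :
  Ex q (map phi r) f = Ex q r (fun F => f [set phi x | x in F]).
Proof.
elim: r f => [|x r IH] f /=; first by rewrite imset0.
rewrite !IH; congr (_ + _ * _); apply: eq_Ex_in => F _.
by rewrite imsetU1.
Qed.

(** * Spins *)

Section Spins.
Variables (R : realFieldType) (V : finType).
Implicit Types (p b : R) (l : seq V).

Lemma notin_sub l x (F : {set V}) : x \notin l -> F \subset l -> x \notin F.
Proof. by move=> xl /subsetP sF; apply: contra xl; apply: sF. Qed.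

Lemma disjointsU1 x (S T : {set V}) :
  x \notin T -> [disjoint x |: S & T] = [disjoint S & T].
Proof. by move=> xT; rewrite !disjoints_subset subUset sub1set inE xT. Qed.

(* A vertex joined to at most one of the two terminals is a three-valued spin:
   absent with weight (1-p)^2, attached to s or to t with weight p(1-p) each.
   It is redrawn as a support Z and, independently, a fair sign P. *)
Lemma Ex_spin p b l (f : {set V} -> {set V} -> R) :
  (1 + p) * b = 2 * p -> uniq l ->
  Ex p l (fun S => Ex p l (fun T => [disjoint S & T]%:R * f S T)) =
  (1 - p ^+ 2) ^+ size l *
    Ex b l (fun Z => Ex (2^-1) l (fun P => f (Z :&: P) (Z :\: P))).
Proof.
move=> hb; elim: l f => [|x l IH] f /=.
  by rewrite disjoints_subset sub0set setI0 setD0 expr0.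
move=> /andP[xl ul].
have h00 := IH f ul.
have h01 := IH (fun S T => f S (x |: T)) ul.
have h10 := IH (fun S T => f (x |: S) T) ul.
rewrite /= in h00 h01 h10.
rewrite (@eq_Ex_in _ _ _ _ _ (fun S =>
   (1 - p) * Ex p l (fun T => [disjoint S & T]%:R * f S T) +
   p * Ex p l (fun T => [disjoint S & T]%:R * f S (x |: T)))); last first.
  move=> S sS; congr (_ + _ * _); apply: eq_Ex_in => T _.
  by rewrite disjoint_sym disjointsU1 ?(notin_sub xl sS) // disjoint_sym.
(* Once the first set contains [x], every [T] containing [x] violates disjointness and contributes
   zero. *)
rewrite (@eq_Ex_in _ _ _ _ (fun S => (1 - p) * Ex p l (fun T => [disjoint x |: S & T]%:R * _) + _) (fun S =>
   (1 - p) * Ex p l (fun T => [disjoint S & T]%:R * f (x |: S) T))); last first.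
  move=> S sS; rewrite -[RHS]addr0; congr (_ * _ + _).
    apply: eq_Ex_in => T sT.
    by rewrite disjointsU1 ?(notin_sub xl sT).
  rewrite (@eq_Ex_in _ _ _ _ _ (fun=> 0)) ?Ex_cst ?mulr0 // => T _.
  have -> : [disjoint x |: S & x |: T] = false.
    by apply/negP => /disjointFr/(_ (setU11 _ _)); rewrite setU11.
  by rewrite mul0r.
rewrite ExD !ExZ h00 h01 h10.
set u := 1 - p ^+ 2; set n := size l.
(* Outside the support the sign of [x] is irrelevant; inside, it sends [x] to either side with equal
   chance. *)
rewrite [X in _ = _ * (_ * X + _)](@eq_Ex_in _ _ b l _ (fun Z => Ex 2^-1 l (fun P => f (Z :&: P) (Z :\: P)))); last first.
  move=> Z sZ /=.
  rewrite (@eq_Ex_in _ _ _ _ (fun P => f (Z :&: (x |: P)) (Z :\: (x |: P)))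
     (fun P => f (Z :&: P) (Z :\: P))); first by field.
  move=> P _; have xZ := notin_sub xl sZ; congr f; apply/setP => y; rewrite !inE;
   by case: eqP => // ->; rewrite (negbTE xZ) ?andbF.
rewrite [X in _ = _ * (_ + b * X)](@eq_Ex_in _ _ b l _ (fun Z =>
   2^-1 * Ex 2^-1 l (fun P => f (Z :&: P) (x |: (Z :\: P))) +
   2^-1 * Ex 2^-1 l (fun P => f (x |: (Z :&: P)) (Z :\: P)))); last first.
  move=> Z sZ; have xZ := notin_sub xl sZ.
  rewrite (_ : 1 - 2^-1 = 2^-1 :> R); last by field.
  congr (_ * _ + _ * _); apply: eq_Ex_in => P sP; have xP := notin_sub xl sP;
   congr f; apply/setP => y; rewrite !inE;
   by case: eqP => // ->; rewrite ?(negbTE xZ) ?(negbTE xP).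
rewrite ExD !ExZ exprSr /u; set X := Ex b l _; set Y := Ex b l _; set W := Ex b l _.
(* The factor [1 - p ^+ 2] splits so that [b] occurs only as [(1 + p) * b], which [hb] evaluates. *)
have -> : (1 - p ^+ 2) ^+ n * (1 - p ^+ 2) * ((1 - b) * X + b * (2^-1 * Y + 2^-1 * W)) =
  (1 - p ^+ 2) ^+ n * ((1 - p ^+ 2 - (1 - p) * ((1 + p) * b)) * X +
      (1 - p) * ((1 + p) * b) * (2^-1 * Y + 2^-1 * W)) by ring.
by rewrite hb; field.
Qed.

(** * Fair signs and Griffiths' inequality *)

Definition sg (P : {set V}) x : R := if x \in P then 1 else -1.

(** A vertex of odd multiplicity in [K] averages to 0 and one of even multiplicity contributes 1, so
    the mean is 0 or 1. [K] is a list because expanding products repeats vertices. *)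
Lemma Ex_sg_ge0 l K : uniq l -> all (mem l) K ->
  0 <= Ex 2^-1 l (fun P => \prod_(v <- K) sg P v).
Proof.
elim: l K => [|x l IH] K /=.
  by move=> _; case: K => //=; rewrite big_nil.
move=> /andP[xl ul] Kl.
set K' := [seq v <- K | v != x].
have K'l : all (mem l) K'.
  apply/allP => v; rewrite mem_filter => /andP[vx vK].
  by have /= := allP Kl v vK; rewrite inE (negbTE vx).
have split P : \prod_(v <- K) sg P v =
    sg P x ^+ count_mem x K * \prod_(v <- K') sg P v.
  rewrite (bigID (pred1 x)) /= big_filter; congr (_ * _).
  rewrite (eq_bigr (fun=> sg P x)) => [|v /eqP->//].
  by rewrite big_const_seq iter_mulr_1.
rewrite (@eq_Ex_in _ _ _ _ _ (fun P => (-1) ^+ count_mem x K * \prod_(v <- K') sg P v)); last first.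
  by move=> P sP; rewrite split {1}/sg (negbTE (notin_sub xl sP)).
rewrite [X in _ + _ * X](@eq_Ex_in _ _ _ _ _ (fun P => \prod_(v <- K') sg P v)); last first.
  move=> P sP; rewrite split {1}/sg setU11 expr1n mul1r.
  apply: eq_big_seq => v; rewrite mem_filter => /andP[vx _].
  by rewrite /sg !inE (negbTE vx).
rewrite ExZ; have := IH K' ul K'l; set E := Ex _ _ _ => E0.
by rewrite -signr_odd; case: odd; rewrite ?expr0 ?expr1; lra.
Qed.

(* Griffiths' inequality: after expanding the product, every monomial in the
   signs has nonnegative mean. *)
Lemma Griffiths (I : eqType) (L : seq I) (x y : I -> V) (c d : I -> R) l K :
  uniq l -> all (mem l) K ->
  (forall i, i \in L -> [/\ x i \in l, y i \in l, 0 <= c i & 0 <= d i]) ->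
  (\prod_(i <- L) c i) * Ex 2^-1 l (fun P => \prod_(v <- K) sg P v) <=
  Ex 2^-1 l (fun P => (\prod_(v <- K) sg P v) *
                      \prod_(i <- L) (c i + d i * (sg P (x i) * sg P (y i)))).
Proof.
move=> ul; elim: L K => [|i L IH] K Kl hL.
  rewrite big_nil mul1r le_eqVlt; apply/orP; left; apply/eqP.
  by apply: eq_Ex_in => P _; rewrite big_nil mulr1.
have [xi yi ci di] := hL i (mem_head _ _).
have hL' j : j \in L -> [/\ x j \in l, y j \in l, 0 <= c j & 0 <= d j].
  by move=> jL; apply: hL; rewrite inE jL orbT.
have K'l : all (mem l) [:: x i, y i & K] by rewrite /= xi yi.
have h1 := IH K Kl hL'; have h2 := IH _ K'l hL'.
(* The term with [c i] keeps the monomial [K]; the term with [d i] appends two signs to it, has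
   nonnegative mean and is dropped. *)
rewrite [leRHS](@eq_Ex_in _ _ _ _ _ (fun P =>
  c i * ((\prod_(v <- K) sg P v) *
                      \prod_(i <- L) (c i + d i * (sg P (x i) * sg P (y i)))) +
  d i * ((\prod_(v <- [:: x i, y i & K]) sg P v) *
                      \prod_(i <- L) (c i + d i * (sg P (x i) * sg P (y i)))))); last first.
  by move=> P _; rewrite !big_cons; ring.
rewrite ExD !ExZ big_cons -mulrA -[leLHS]addr0; apply: lerD.
  exact: ler_wpM2l.
apply: mulr_ge0 => //; apply: le_trans h2; apply: mulr_ge0; last exact: Ex_sg_ge0.
by rewrite big_seq; apply: prodr_ge0 => j /hL'[].
Qed.

Definition opposite (S T : {set V}) (x y : V) : bool :=
  (x \in S) && (y \in T) || (y \in S) && (x \in T).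

(** This is 1 - p b^2 / 2 with b = 2p / (1 + p): an inner edge completes a path when both ends are
    attached (b^2), to opposite terminals (1/2), and the edge survives (p). *)
Definition gfac p : R := 1 - 2 * p ^+ 3 / (1 + p) ^+ 2.

(** The indicator of opposite signs is half of one minus their product. This gives the shape c + d *
    sign * sign with c, d >= 0 for 0 <= p <= 1, as Griffiths' inequality requires. *)
Lemma opposite_sg p (Z P : {set V}) x y :
  1 - p * (opposite (Z :&: P) (Z :\: P) x y)%:R =
  (1 - p / 2 * ((x \in Z) && (y \in Z))%:R) +
  (p / 2 * ((x \in Z) && (y \in Z))%:R) * (sg P x * sg P y).
Proof.
rewrite /opposite /sg !inE.
by case: (x \in Z); case: (y \in Z); case: (x \in P); case: (y \in P) => /=;
  rewrite ?mulr0n ?mulr1n; field.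
Qed.

(** For p < 1, the ratio 2p / (1 + p) equals 2p(1 - p) / (1 - p^2), the chance that a vertex is
    attached to a terminal, given that it is not attached to both. *)
Lemma spin_facts p : 0 <= p <= 1 ->
  [/\ (1 + p) * (2 * p / (1 + p)) = 2 * p, 0 <= 2 * p / (1 + p) <= 1,
      0 <= 1 - p ^+ 2 &
      1 - p / 2 * (2 * p / (1 + p)) ^+ 2 = gfac p].
Proof.
move=> /andP[p0 p1]; have p1' : 0 < 1 + p by lra.
split; [by field; lra| |nra|by rewrite /gfac; field; lra].
by rewrite divr_ge0 ?ler_pdivrMr //; lra.
Qed.

Lemma Ex_both b l (x y : V) c : uniq l -> x \in l -> y \in l -> x != y ->
  Ex b l (fun Z => 1 - c * ((x \in Z) && (y \in Z))%:R) = 1 - c * b ^+ 2 :> R.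
Proof.
move=> ul xl yl xy.
by rewrite (Ex_pair _ (fun i j => 1 - c * (i && j)%:R)) //=; ring.
Qed.

(** For a fixed support, Griffiths' inequality discards the sign terms. The factors left are
    antitone in the support, so Harris' inequality bounds the mean of their product below by the
    product of their means, each equal to [gfac p]. *)
Lemma Ex_opposite_ge p l (I : eqType) (L : seq I) (x y : I -> V) :
  0 <= p <= 1 -> uniq l ->
  (forall i, i \in L -> [/\ x i \in l, y i \in l & x i != y i]) ->
  (1 - p ^+ 2) ^+ size l * gfac p ^+ size L <=
  Ex p l (fun S => Ex p l (fun T => [disjoint S & T]%:R *
     \prod_(i <- L) (1 - p * (opposite S T (x i) (y i))%:R))).
Proof.
move=> hp ul hL; have [hb b01 u0 hg] := spin_facts hp.
have /andP[p0 p1] := hp.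
rewrite (Ex_spin _ hb ul); apply: ler_wpM2l; first exact: exprn_ge0.
set b := 2 * p / (1 + p).
pose c i (Z : {set V}) : R := 1 - p / 2 * ((x i \in Z) && (y i \in Z))%:R.
have c0 i Z : 0 <= c i Z by rewrite /c; case: andb => /=; lra.
apply: (@le_trans _ _ (Ex b l (fun Z => \prod_(i <- L) c i Z))); last first.
  apply: le_Ex_in => // Z _.
  have := @Griffiths _ L x y (fun i => c i Z)
    (fun i => p / 2 * ((x i \in Z) && (y i \in Z))%:R) l [::] ul isT.
  rewrite (@eq_Ex_in _ _ _ _ _ (fun=> 1)); last by move=> P _; rewrite big_nil.
  rewrite Ex_cst mulr1 => /(_ _)/le_trans -> //.
    move=> i iL; have [? ? _] := hL i iL; split=> //.
    by case: andb => /=; lra.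
  rewrite le_eqVlt; apply/orP; left; apply/eqP; apply: eq_Ex_in => P _.
  by rewrite big_nil mul1r; apply: eq_bigr => i _; rewrite opposite_sg.
apply: le_trans (Harris_prod _ b01 _ _) => //.
  rewrite (eq_big_seq (fun=> gfac p)); last first.
    by move=> i iL; have [? ? ?] := hL i iL; rewrite Ex_both.
  by rewrite big_const_seq count_predT iter_mulr_1.
move=> i _ F G /subsetP FG; rewrite /c lerD2l lerN2; apply: ler_wpM2l; first lra.
rewrite ler_nat; case: andP => // -[/FG -> /FG ->] //.
Qed.

(** With a single edge nothing is lost: the product of two distinct signs has mean zero. *)
Lemma Ex_opposite1 p l (x y : V) :
  0 <= p <= 1 -> uniq l -> x \in l -> y \in l -> x != y ->
  Ex p l (fun S => Ex p l (fun T => [disjoint S & T]%:R *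
     (1 - p * (opposite S T x y)%:R))) = (1 - p ^+ 2) ^+ size l * gfac p.
Proof.
move=> hp ul xl yl xy; have [hb b01 u0 hg] := spin_facts hp.
rewrite (Ex_spin _ hb ul); congr (_ * _); rewrite -hg -(Ex_both _ _ ul xl yl xy).
apply: eq_Ex_in => Z _.
rewrite (@eq_Ex_in _ _ _ _ _ (fun P => (1 - p / 2 * ((x \in Z) && (y \in Z))%:R) +
  (p / 2 * ((x \in Z) && (y \in Z))%:R) * (sg P x * sg P y))); last first.
  by move=> P _; rewrite opposite_sg.
rewrite ExD ExZ Ex_cst.
rewrite (Ex_pair _ (fun i j => (if i then 1 else -1) * (if j then 1 else -1))) //=.
by field.
Qed.

Lemma Ex_opposite0 p l : 0 <= p <= 1 -> uniq l ->
  Ex p l (fun S => Ex p l (fun T => [disjoint S & T]%:R)) = (1 - p ^+ 2) ^+ size l.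
Proof.
move=> hp ul; have [hb b01 u0 hg] := spin_facts hp.
have := Ex_spin (fun _ _ => 1) hb ul; rewrite !Ex_cst mulr1.
move=> <-; apply: eq_Ex_in => S _; apply: eq_Ex_in => T _; by rewrite mulr1.
Qed.

End Spins.

(** * Scalar estimates *)

Section Estimates.
Variable R : realFieldType.
Implicit Types (p : R) (i j k : nat).

Definition bnd p k : R := (1 - p ^+ 2) ^+ k./2 * gfac p ^+ odd k.
(** Failure factor of a one-sided vertex charged with [j] edges: its link to the terminal is
    deleted, or it survives and all [j] two-edge continuations fail. *)
Definition phi p j : R := (1 - p) + p * (1 - p ^+ 2) ^+ j.

(** Clearing the denominator leaves polynomial constraints, which [nra] can handle. *)
Lemma gfacE p : 0 <= p ->
  exists2 x, x * (1 + p) ^+ 2 = p ^+ 3 & gfac p = 1 - 2 * x.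
Proof.
move=> p0; have h : 1 + p != 0 by lra.
by exists (p ^+ 3 / (1 + p) ^+ 2); rewrite /gfac; field.
Qed.

(** With [gfac p] written as 1 - 2x, the bound 4x <= p^2 suffices: (1 - 2x)^2 >= 1 - 4x >= 1 -
    p^2. *)
Lemma gfac_weak p : 0 <= p <= 1 ->
  [/\ 1 / 2 <= gfac p, gfac p <= 1 & 1 - p ^+ 2 <= gfac p ^+ 2].
Proof.
move=> /andP[p0 p1]; have [x hx ->] := gfacE p0.
have D1 : 1 <= (1 + p) ^+ 2 by nra.
have x0 : 0 <= x by have := exprn_ge0 3 p0; nra.
have x1 : 4 * x <= p ^+ 2.
  have : (p ^+ 2 - 4 * x) * (1 + p) ^+ 2 = p ^+ 2 * (1 - p) ^+ 2.
    transitivity (p ^+ 2 * (1 + p) ^+ 2 - 4 * (x * (1 + p) ^+ 2)).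
      by ring.
    by rewrite hx; ring.
  have : 0 <= p ^+ 2 * (1 - p) ^+ 2 by rewrite mulr_ge0 ?sqr_ge0.
  nra.
split; nra.
Qed.

Lemma gfac_strict p : 0 < p < 1 -> gfac p < 1 /\ 1 - p ^+ 2 < gfac p ^+ 2.
Proof.
move=> /andP[p0 p1]; have [x hx ->] := gfacE (ltW p0).
have D1 : 1 <= (1 + p) ^+ 2 by nra.
have x0 : 0 < x by have := exprn_gt0 3 p0; nra.
have x1 : 4 * x < p ^+ 2.
  have : (p ^+ 2 - 4 * x) * (1 + p) ^+ 2 = p ^+ 2 * (1 - p) ^+ 2.
    transitivity (p ^+ 2 * (1 + p) ^+ 2 - 4 * (x * (1 + p) ^+ 2)).
      by ring.
    by rewrite hx; ring.
  have : 0 < p ^+ 2 * (1 - p) ^+ 2 by rewrite mulr_gt0 ?exprn_gt0 ?subr_gt0.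
  nra.
split; nra.
Qed.

Lemma u_facts p : 0 <= p <= 1 -> 0 <= 1 - p ^+ 2 <= 1.
Proof. by move=> /andP[p0 p1]; nra. Qed.

(** For p <= 1/2 an explicit decomposition shows positivity; for larger p, completing the square in
    [y] leaves the remainder (1 + p)(3p - 1) > 0. *)
Lemma quad_odd p y : 0 <= y <= 1 -> 0 < p -> 0 < 1 - (1 + p) * y + p * (1 + p) * y ^+ 2.
Proof.
move=> /andP[y0 y1] p0; have [h|h] := lerP p (1 / 2).
  have -> : 1 - (1 + p) * y + p * (1 + p) * y ^+ 2 =
    p ^+ 2 + (1 - y) * (1 + p) * (1 - p * (1 + y)) by ring.
  have h1 : 0 <= 1 - p * (1 + y) by nra.
  have : 0 <= (1 - y) * (1 + p) * (1 - p * (1 + y)) by rewrite !mulr_ge0 //; lra.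
  have : 0 < p ^+ 2 by rewrite exprn_gt0.
  lra.
have : 4 * p * (1 + p) * (1 - (1 + p) * y + p * (1 + p) * y ^+ 2) =
  (2 * p * (1 + p) * y - (1 + p)) ^+ 2 + (1 + p) * (3 * p - 1) by ring.
have : 0 <= (2 * p * (1 + p) * y - (1 + p)) ^+ 2 by exact: sqr_ge0.
have : 0 < (1 + p) * (3 * p - 1) by rewrite mulr_gt0 //; lra.
have : 0 < 4 * p * (1 + p) by nra.
nra.
Qed.

(** With y = (1 - p^2)^i, the difference of the two sides is 1 - p times the quadratic of
    [quad_odd]. *)
Lemma phi_odd p i : 0 <= p < 1 ->
  (0 < p -> bnd p i.*2.+2 < phi p i.*2.+1) /\ bnd p i.*2.+2 <= phi p i.*2.+1.
Proof.
move=> /andP[p0 p1].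
have /andP[u0 u1] : 0 <= 1 - p ^+ 2 <= 1 by apply: u_facts; rewrite p0 ltW.
rewrite /bnd /phi /= odd_double doubleK /= expr0 mulr1 -addnn.
set u := 1 - p ^+ 2; rewrite (exprS u i) (exprS u (i + i)) exprD; set y := u ^+ i.
have hy : 0 <= y <= 1 by rewrite exprn_ge0 ?exprn_ile1.
have e : (1 - p) + p * (u * (y * y)) - u * y =
  (1 - p) * (1 - (1 + p) * y + p * (1 + p) * y ^+ 2) by rewrite /u; ring.
have s : 0 < p -> u * y < (1 - p) + p * (u * (y * y)).
  by move=> p0'; rewrite -subr_gt0 e mulr_gt0 ?quad_odd ?subr_gt0.
split=> //; move: p0; rewrite le_eqVlt => /orP[/eqP p0|/s/ltW //].
have /andP[_ y1] := hy; rewrite /u -p0; nra.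
Qed.

(** This is 2p(1 - p^2) <= [gfac p] multiplied by (1 + p)^2. *)
Lemma quad_mid p : 0 <= p <= 1 ->
  0 <= (1 + p) ^+ 2 - 2 * p ^+ 3 - 2 * p * (1 - p ^+ 2) * (1 + p) ^+ 2.
Proof.
move=> /andP[p0 p1].
(* The maximum of p(1 - p^2) is about 0.385, at 1 / sqrt 3, close to 0.577. The product (p - a)^2 (p
   + 2a) = p^3 - 3 a^2 p + 2 a^3 certifies this with a = 577/1000. *)
have h : p * (1 - p ^+ 2) <= 39 / 100.
  have : 0 <= (p - 577 / 1000) ^+ 2 * (p + 1154 / 1000).
    by rewrite mulr_ge0 ?sqr_ge0 //; lra.
  nra.
have -> : (1 + p) ^+ 2 - 2 * p ^+ 3 - 2 * p * (1 - p ^+ 2) * (1 + p) ^+ 2 =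
  1 - 3 * p ^+ 2 + 4 * (p ^+ 2) ^+ 2 - 2 * p ^+ 2 * (p * (1 - p ^+ 2)) by ring.
have q0 : 0 <= p ^+ 2 by exact: sqr_ge0.
have := ler_wpM2l q0 h.
(* With q = p^2 it remains to see 4 q^2 - 3.78 q + 1 >= 0, whose vertex is at q = 378/800. *)
have : 0 <= (p ^+ 2 - 378 / 800) ^+ 2 by exact: sqr_ge0.
nra.
Qed.

(** The case of exponent 0 is [gfac p] <= 1. Otherwise, with z = u^i, the difference (1 - p) + p z^2
    - g z is nonincreasing for z <= u because 2pu <= g, so the worst case is z = u, where it factors
    explicitly. *)
Lemma phi_even p i : 0 <= p < 1 ->
  (0 < p -> bnd p i.*2.+1 < phi p i.*2) /\ bnd p i.*2.+1 <= phi p i.*2.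
Proof.
move=> /andP[p0 p1]; have hp : 0 <= p <= 1 by rewrite p0 ltW.
have /andP[u0 u1] := u_facts hp.
have [g0 g1 _] := gfac_weak hp.
rewrite /bnd /phi /= odd_double uphalf_double expr1; case: i => [|i].
  rewrite !expr0 mul1r mulr1; split=> [p0'|]; last lra.
  have /gfac_strict[] : 0 < p < 1 by rewrite p0' p1.
  lra.
rewrite -addnn exprD.
set u := 1 - p ^+ 2; rewrite exprS; set w := u ^+ i; set g := gfac p.
have hw : 0 <= w <= 1 by rewrite exprn_ge0 ?exprn_ile1.
have /andP[w0 w1] := hw.
have [x hx gx] := gfacE p0.
have D1 : 1 <= (1 + p) ^+ 2 by nra.
have gpu : 2 * p * u <= g.
  have e : (g - 2 * p * u) * (1 + p) ^+ 2 =
    (1 + p) ^+ 2 - 2 * p ^+ 3 - 2 * p * u * (1 + p) ^+ 2.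
    by rewrite -hx /g gx; ring.
  have := quad_mid hp; rewrite -/u -e; nra.
have hu : ((1 - p) + p * u ^+ 2 - g * u) * (1 + p) =
    (1 - p) * p ^+ 2 * (1 + 2 * p - 2 * p ^+ 2 - p ^+ 3).
  have -> : ((1 - p) + p * u ^+ 2 - g * u) * (1 + p) =
     (1 - p) * (1 + p - (1 + p) ^+ 2 + 2 * (x * (1 + p) ^+ 2) + p * (1 - p) * (1 + p) ^+ 3).
    by rewrite /g gx /u; ring.
  by rewrite hx; ring.
(* The value at z = u plus the nonnegative increment down to z = u w. *)
have e : (1 - p) + p * (u * w * (u * w)) - u * w * g =
   ((1 - p) + p * u ^+ 2 - g * u) + (u * (1 - w)) * ((g - 2 * p * u) + p * (u * (1 - w))).
  by ring.
have r0 : 0 <= (u * (1 - w)) * ((g - 2 * p * u) + p * (u * (1 - w))).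
  have h1 : 0 <= u * (1 - w) by rewrite mulr_ge0 // subr_ge0.
  by rewrite mulr_ge0 // addr_ge0 ?subr_ge0 // mulr_ge0.
have c0 : 0 < 1 + 2 * p - 2 * p ^+ 2 - p ^+ 3.
  have : 0 <= p * (1 - p) by rewrite mulr_ge0 ?subr_ge0 // ltW.
  have : 0 <= p ^+ 2 * (1 - p) by rewrite mulr_ge0 ?sqr_ge0 ?subr_ge0 // ltW.
  nra.
split=> [p0'|].
  have : 0 < (1 - p) * p ^+ 2 * (1 + 2 * p - 2 * p ^+ 2 - p ^+ 3).
    by apply: mulr_gt0 => //; rewrite mulr_gt0 ?subr_gt0 ?exprn_gt0.
  rewrite -hu => h; rewrite -subr_gt0 e; apply: ltr_wpDr => //; nra.
have : 0 <= (1 - p) * p ^+ 2 * (1 + 2 * p - 2 * p ^+ 2 - p ^+ 3).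
  by apply: mulr_ge0; [rewrite mulr_ge0 ?sqr_ge0 ?subr_ge0 // ltW|exact: ltW].
rewrite -hu => h; rewrite -subr_ge0 e; apply: addr_ge0 => //; nra.
Qed.

Lemma bnd_ge0 p k : 0 <= p <= 1 -> 0 <= bnd p k.
Proof.
move=> hp; have /andP[u0 u1] := u_facts hp; have [g0 g1 _] := gfac_weak hp.
by rewrite /bnd mulr_ge0 ?exprn_ge0 //; lra.
Qed.

Lemma bnd_gt0 p k : 0 < p < 1 -> 0 < bnd p k.
Proof.
move=> /andP[p0 p1]; have hp : 0 <= p <= 1 by rewrite !ltW.
have [g0 g1 _] := gfac_weak hp.
have u0 : 0 < 1 - p ^+ 2 by nra.
have g0' : 0 < gfac p by lra.
by rewrite /bnd mulr_gt0 ?exprn_gt0.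
Qed.

(** The index [j.+1] counts the edges a one-sided vertex accounts for: its link to a terminal and
    the [j] edges charged to it. *)
Lemma phi_ge p j : 0 <= p <= 1 -> bnd p j.+1 <= phi p j.
Proof.
move=> hp; have /andP[p0 p1] := hp; move: p1; rewrite le_eqVlt => /orP[/eqP p1|p1].
  case: j => [|j].
    by have [_ g1 _] := gfac_weak hp; rewrite /bnd /phi /= expr0 mul1r expr1 mulr1; lra.
  by rewrite /bnd /phi p1 expr1n subrr add0r mul1r /= !exprS !mul0r.
have hp' : 0 <= p < 1 by rewrite p0.
rewrite -(odd_double_half j); case: odd; rewrite ?add1n ?add0n.
  by have [] := phi_odd j./2 hp'.
by have [] := phi_even j./2 hp'.
Qed.

Lemma phi_gt p j : 0 < p < 1 -> bnd p j.+1 < phi p j.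
Proof.
move=> /andP[p0 p1]; have hp' : 0 <= p < 1 by rewrite ltW.
rewrite -(odd_double_half j); case: odd; rewrite ?add1n ?add0n.
  by have [+ _] := phi_odd j./2 hp'; apply.
by have [+ _] := phi_even j./2 hp'; apply.
Qed.

(** The halves add exactly unless both numbers are odd; the carry then replaces g^2 by the smaller 1
    - p^2. *)
Lemma bndD p j k : 0 <= p <= 1 -> bnd p (j + k) <= bnd p j * bnd p k.
Proof.
move=> hp; have /andP[u0 u1] := u_facts hp; have [g0 g1 hg] := gfac_weak hp.
rewrite /bnd halfD oddD mulrACA -exprD (exprD _ (_ && _)).
have w0 : 0 <= (1 - p ^+ 2) ^+ (j./2 + k./2) by exact: exprn_ge0.
case: (odd j); case: (odd k); rewrite /= ?expr0 ?expr1 ?mulr1 ?mul1r //.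
by rewrite mulrC; apply: ler_wpM2l.
Qed.

Lemma bnd2 p : 0 < p < 1 -> bnd p 2 < bnd p 1 ^+ 2.
Proof. by move=> /gfac_strict[_]; rewrite /bnd /= expr0 mul1r mulr1 !expr1. Qed.

Lemma bnd_le1 p k : 0 <= p <= 1 -> bnd p k <= 1.
Proof.
move=> hp; have /andP[u0 u1] := u_facts hp; have [g0 g1 _] := gfac_weak hp.
by rewrite /bnd mulr_ile1 ?exprn_ge0 ?exprn_ile1 //; lra.
Qed.

Lemma bnd_lt1 p k : 0 < p < 1 -> (0 < k)%N -> bnd p k < 1.
Proof.
move=> hp; have /andP[p0 p1] := hp; have [g1 _] := gfac_strict hp.
have hp' : 0 <= p <= 1 by rewrite !ltW.
have [g0 _ _] := gfac_weak hp'.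
have b1 : bnd p 1 < 1 by rewrite /bnd /= expr0 mul1r expr1.
have b2 : bnd p 2 < 1 by rewrite /bnd /= mulr1 expr1; nra.
have b0 i : 0 <= bnd p i <= 1 by rewrite bnd_ge0 ?bnd_le1.
case: k => [//|[//|k]] _; apply: le_lt_trans (bndD 2 k hp') _.
have /andP[? ?] := b0 k; have /andP[? ?] := b0 2%N; nra.
Qed.

(** An edge spent on [st] costs at most what it would cost elsewhere. By parity this reduces to 1 -
    p <= g or to (1 - p) g <= 1 - p^2. *)
Lemma bndS p k : 0 <= p <= 1 -> (1 - p) * bnd p k <= bnd p k.+1.
Proof.
move=> hp; have /andP[p0 p1] := hp.
have /andP[u0 u1] := u_facts hp; have [g0 g1 _] := gfac_weak hp.
have [x hx gx] := gfacE p0.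
have hg : 1 - p <= gfac p.
  rewrite gx; suff : 2 * x <= p by lra.
  have : 1 <= (1 + p) ^+ 2 by nra.
  nra.
rewrite /bnd /= uphalf_half; case: (odd k) => /=; last first.
  by rewrite !expr0 mulr1 expr1 add0n mulrC; apply: ler_wpM2l; rewrite ?exprn_ge0.
rewrite expr1 expr0 mulr1 add1n (exprS _ k./2) mulrCA [leRHS]mulrC; apply: ler_wpM2l; rewrite ?exprn_ge0 //; nra.
Qed.

Lemma bndS_lt p k : 0 < p < 1 -> (1 - p) * bnd p k < bnd p k.+1.
Proof.
move=> hp; have /andP[p0 p1] := hp; have hp' : 0 <= p <= 1 by rewrite !ltW.
have [g0 g1 _] := gfac_weak hp'.
have [x hx gx] := gfacE (ltW p0).
have u0 : 0 < 1 - p ^+ 2 by nra.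
have hg : 1 - p < gfac p.
  rewrite gx; suff : 2 * x < p by lra.
  have : 1 < (1 + p) ^+ 2 by nra.
  nra.
rewrite /bnd /= uphalf_half; case: (odd k) => /=; last first.
  by rewrite !expr0 mulr1 expr1 add0n mulrC ltr_pM2l ?exprn_gt0.
rewrite expr1 expr0 mulr1 add1n (exprS _ k./2) mulrCA [ltRHS]mulrC ltr_pM2l ?exprn_gt0 //; nra.
Qed.

End Estimates.

(** * Unreliability of a two-terminal graph *)

Section Booleans.
Variables (R : realFieldType) (T : finType).
Implicit Types (q : R) (r : seq T).

Lemma Ex_restrict q r r0 (f : {set T} -> R) :
  uniq r -> uniq r0 -> {subset r0 <= r} ->
  (forall F G : {set T}, {in r0, forall x, (x \in F) = (x \in G)} -> f F = f G) ->
  Ex q r f = Ex q r0 f.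
Proof.
move=> ur u0 s0 hf; pose r1 := [seq x <- r | x \notin r0].
have p : perm_eq r (r0 ++ r1).
  apply: uniq_perm => //.
    rewrite cat_uniq u0 filter_uniq // andbT; apply/hasPn => x /=.
    by rewrite mem_filter => /andP[].
  move=> x; rewrite mem_cat mem_filter; case x0 : (x \in r0) => //=.
  exact: s0.
rewrite (perm_Ex _ _ ur p) Ex_cat; apply: eq_Ex_in => F _.
rewrite -[RHS](Ex_cst q r1); apply: eq_Ex_in => G /subsetP sG; apply: hf => x x0.
rewrite !inE; case xG : (x \in G); last by rewrite orbF.
by have := sG x xG; rewrite mem_filter x0.
Qed.

Lemma prod_negb (I : Type) (r : seq I) (b : I -> bool) :
  \prod_(i <- r) (~~ b i)%:R = (~~ has b r)%:R :> R.
Proof.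
elim: r => [|i r IH]; first by rewrite big_nil.
by rewrite big_cons IH /= negb_or; case: (b i); rewrite ?mul0r ?mul1r.
Qed.

Lemma antitone_negb (b : {set T} -> bool) :
  (forall F G : {set T}, F \subset G -> b F -> b G) ->
  antitone (fun F => (~~ b F)%:R : R).
Proof.
move=> hb F G FG; rewrite ler_nat; case bF : (b F) => /=; last by case: (b G).
by rewrite (hb _ _ FG bF).
Qed.

Lemma Ex_notin q r x (f : {set T} -> R) : uniq r -> x \in r ->
  (forall F, f (x |: F) = f F) ->
  Ex q r (fun F => (x \notin F)%:R * f F) = (1 - q) * Ex q r f.
Proof.
move=> ur xr hf; have p := perm_to_rem xr.
rewrite !(perm_Ex _ _ ur p) /=.
have xr' : x \notin rem x r by rewrite mem_rem_uniq // inE eqxx.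
rewrite (@eq_Ex_in _ _ _ _ _ f); last first.
  by move=> F sF; rewrite (notin_sub xr' sF) mul1r.
rewrite (@eq_Ex_in _ _ _ _ (fun F => _ * f (x |: F)) (fun=> 0)); last first.
  by move=> F sF; rewrite setU11 mul0r.
rewrite (@eq_Ex_in _ _ _ _ (fun F => f (x |: F)) f) // Ex_cst; ring.
Qed.

End Booleans.

Lemma eq_set2 (V : finType) (a b c d : V) :
  [set a; b] = [set c; d] -> (a = c /\ b = d) \/ (a = d /\ b = c).
Proof.
move=> e.
have := set21 a b; have := set22 a b; have := set21 c d; have := set22 c d.
rewrite -{1 2}e {3 4}e !inE.
by move=> /orP[]/eqP h1 /orP[]/eqP h2 /orP[]/eqP h3 /orP[]/eqP h4; intuition congruence.
Qed.

Lemma cardsU_split (T : finType) (P : pred T) (A B : {set T}) :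
  {in A, forall e, P e} -> {in B, forall e, ~~ P e} -> #|A :|: B| = (#|A| + #|B|)%N.
Proof.
move=> hA hB; apply/eqP; rewrite (leq_card_setU A B).2.
by apply/pred0P => e /=; apply/negP => /andP[/hA h /hB]; rewrite h.
Qed.

Section Graph.
Variables (R : realFieldType) (V : finType) (s t : V) (E : {set {set V}}).
Hypothesis st : s != t.
Hypothesis E2 : forall e, e \in E -> #|e| = 2%N.
Implicit Types (F G : {set {set V}}) (e : {set V}) (x y : V).

Definition inner x := (x != s) && (x != t).

Definition short F : bool :=
  [|| [set s; t] \in F,
      [exists x, [&& inner x, [set s; x] \in F & [set t; x] \in F]] |
      [exists x, exists y, [&& inner x, inner y, x != y, [set s; x] \in F,
         [set x; y] \in F & [set t; y] \in F]]].

Definition both := [set x | ([set s; x] \in E) && ([set t; x] \in E)].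
Definition onesided :=
  [set x | inner x && (([set s; x] \in E) (+) ([set t; x] \in E))].
Definition near x := if [set s; x] \in E then s else t.
Definition far x := if [set s; x] \in E then t else s.
(* Every useful edge xy with x one-sided is charged to a single one-sided end:
   the one adjacent to s if there is one. *)
Definition star x :=
  [set y | [&& inner y, [set x; y] \in E, [set far x; y] \in E
             & ([set s; x] \in E) || ([set near x; y] \in E)]].
Definition inside := [set e : {set V} | (e \in E) && (e \subset both)].

(** An arbitrary but fixed ordering of the two ends; the default is reached only by sets that are
    not pairs. *)
Definition ends (e : {set V}) : V * V :=
  odflt (s, s) [pick xy | (e == [set xy.1; xy.2]) && (xy.1 != xy.2)].

Lemma endsP (e : {set V}) : #|e| = 2%N ->
  e = [set (ends e).1; (ends e).2] /\ (ends e).1 != (ends e).2.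
Proof.
move=> h; have /cards2P[x [y [xy ->]]] : #|e| == 2%N by rewrite h.
rewrite /ends; case: pickP => /=.
  by move=> z /andP[/eqP -> ->].
by move=> /(_ (x, y)) /=; rewrite eqxx xy.
Qed.

Lemma loopN x : [set x; x] \notin E.
Proof. by apply/negP => /E2; rewrite setUid cards1. Qed.

Lemma both_inner x : x \in both -> inner x.
Proof.
rewrite inE /inner => /andP[sx tx].
apply/andP; split; apply/negP => /eqP e; rewrite e in sx tx.
  by rewrite (negbTE (loopN _)) in sx.
by rewrite (negbTE (loopN _)) in tx.
Qed.

Lemma onesided_inner x : x \in onesided -> inner x.
Proof. by rewrite inE => /andP[]. Qed.

(** * Failure events of paths through [both] and through one-sided vertices *)

Definition attached a F := [set x in both | [set a; x] \in F].

Definition badA F : bool :=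
  ~~ [disjoint attached s F & attached t F] ||
  has (fun e => (e \in F) &&
    opposite (attached s F) (attached t F) (ends e).1 (ends e).2) (enum inside).

(** A surviving path of length three formed by the link of [x] to its terminal, an edge charged to
    [x], and a link to the other terminal. *)
Definition bad x F : bool :=
  ([set near x; x] \in F) &&
  has (fun y => ([set x; y] \in F) && ([set far x; y] \in F)) (enum (star x)).

Lemma attachedS a F G : F \subset G -> attached a F \subset attached a G.
Proof.
by move=> /subsetP FG; apply/subsetP => x; rewrite !inE => /andP[-> /FG ->].
Qed.

Lemma badA_mono F G : F \subset G -> badA F -> badA G.
Proof.
move=> FG; have /subsetP sS := attachedS s FG; have /subsetP tS := attachedS t FG.
case/orP => [/negP d|/hasP[e eI /andP[eF o]]]; apply/orP.
  left; apply/negP => d'; apply: d; apply: disjointWl (introT subsetP sS) _.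
  exact: disjointWr (introT subsetP tS) d'.
right; apply/hasP; exists e => //; rewrite (subsetP FG) //=.
by case/orP: o => /andP[/sS a /tS b]; apply/orP; [left|right]; rewrite a b.
Qed.

Lemma bad_mono x F G : F \subset G -> bad x F -> bad x G.
Proof.
move=> /subsetP FG /andP[/FG a /hasP[y ys /andP[/FG b /FG c]]].
by rewrite /bad a; apply/hasP; exists y => //; rewrite b c.
Qed.

(** On a path s x y t, if [x] is not a common neighbour it is one-sided and charged with xy.
    Otherwise, if [y] is not one, [y] is one-sided and charged. If both are, xy is an inner edge
    with oppositely attached ends. *)
Lemma short_cases F : F \subset E -> short F ->
  [|| [set s; t] \in F, badA F | has (fun x => bad x F) (enum onesided)].
Proof.
move=> /subsetP FE /or3P[->//|/existsP[x /and3P[ix sx tx]]|].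
  apply/orP; right; apply/orP; left; apply/orP; left; apply/negP => /pred0P/(_ x).
  by rewrite /= !inE sx tx !FE.
move=> /existsP[x /existsP[y /and5P[ix iy xy sx /andP[exy ty]]]].
apply/orP; right.
have sxE := FE _ sx; have tyE := FE _ ty; have xyE := FE _ exy.
case xA : (x \in both); last first.
  apply/orP; right; apply/hasP; exists x.
    by rewrite mem_enum inE ix sxE; move: xA; rewrite inE sxE /= => ->.
  rewrite /bad /near sxE sx; apply/hasP; exists y; last by rewrite /far sxE exy ty.
  by rewrite mem_enum inE iy xyE /far sxE tyE.
case yA : (y \in both); last first.
  move: (yA); rewrite inE tyE andbT => syN.
  apply/orP; right; apply/hasP; exists y.
    by rewrite mem_enum inE iy tyE syN.
  rewrite /bad /near syN ty; apply/hasP; exists x.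
    by rewrite mem_enum inE ix /far /near syN setUC xyE sxE; move: xA; rewrite inE => /andP[_ ->].
  by rewrite /far syN setUC exy sx.
apply/orP; left; apply/orP; right; apply/hasP; exists [set x; y].
  by rewrite mem_enum inE xyE; apply/subsetP => z; rewrite !inE => /orP[] /eqP ->;
   [move: xA|move: yA]; rewrite inE.
rewrite exy /=; have [e _] := endsP (E2 xyE).
have xS : x \in attached s F by rewrite inE xA sx.
have yT : y \in attached t F by rewrite inE yA ty.
rewrite /opposite.
by case: (eq_set2 e) => -[<- <-]; rewrite xS yT ?orbT.
Qed.

Lemma badA_short F : badA F -> short F.
Proof.
have [d|nd] := boolP [disjoint attached s F & attached t F]; last first.
  move=> _; apply/or3P/Or32; apply/existsP.
  move: nd => /pred0Pn[x /=]; rewrite !inE => /andP[/andP[xA sx] /andP[_ tx]].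
  by exists x; rewrite sx tx both_inner // inE.
rewrite /badA d /= => /hasP[e]; rewrite mem_enum inE => /andP[eE eA] /andP[eF o].
have [ee ne] := endsP (E2 eE).
apply/or3P/Or33/existsP; case/orP: o => /andP[xS yT].
  exists (ends e).1; apply/existsP; exists (ends e).2.
  move: xS yT; rewrite !inE => /andP[xA sx] /andP[yA ty].
  by rewrite sx ty -ee eF ne !both_inner // inE.
exists (ends e).2; apply/existsP; exists (ends e).1.
move: xS yT; rewrite !inE => /andP[xA sx] /andP[yA ty].
by rewrite sx ty setUC -ee eF eq_sym ne !both_inner // inE.
Qed.

Lemma sx_neq_tx x y : inner x -> inner y -> [set s; x] != [set t; y].
Proof.
move=> /andP[xs xt] /andP[ys yt]; apply/eqP => /eq_set2[[e _]|[e _]].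
  by move: st; rewrite e eqxx.
by rewrite e eqxx in ys.
Qed.

Lemma set2I (a x y : V) : [set a; x] = [set a; y] -> x = y.
Proof. by case/eq_set2 => -[h1 h2]; congruence. Qed.

(** The event depends on three disjoint families: links from [s] to [both], links from [t] to
    [both], and inner edges. The first two become the random sets [S] and [T]; averaging over the
    third gives the product, by [Ex_prod] read backwards. *)
Lemma Ex_badA (p : R) :
  Ex p (enum E) (fun F => (~~ badA F)%:R) =
  Ex p (enum both) (fun S => Ex p (enum both) (fun T => [disjoint S & T]%:R *
     \prod_(e <- enum inside) (1 - p * (opposite S T (ends e).1 (ends e).2)%:R))).
Proof.
pose As := [seq [set s; x] | x <- enum both].
pose At := [seq [set t; x] | x <- enum both].
have AsI e : e \in As -> e \notin enum inside.
  move=> /mapP[x _ ->]; rewrite mem_enum inE negb_and; apply/orP; right.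
  apply/negP => /subsetP/(_ s); rewrite set21 => /(_ isT)/both_inner.
  by rewrite /inner eqxx.
have AtI e : e \in At -> e \notin enum inside.
  move=> /mapP[x _ ->]; rewrite mem_enum inE negb_and; apply/orP; right.
  apply/negP => /subsetP/(_ t); rewrite set21 => /(_ isT)/both_inner.
  by rewrite /inner eqxx andbF.
have AsAt e : e \in As -> e \notin At.
  move=> /mapP[x]; rewrite mem_enum => xA ->; apply/negP => /mapP[y].
  rewrite mem_enum => yA /eqP; apply/negP; exact: sx_neq_tx (both_inner _) (both_inner _).
rewrite (@Ex_restrict _ _ _ _ (As ++ At ++ enum inside)); first last.
- move=> F G FG.
  have aE a : [seq [set a; x] | x <- enum both] \subset As ++ At ++ enum inside ->
      attached a F = attached a G.
    move=> /subsetP h; apply/setP => x; rewrite [LHS]in_set [RHS]in_set.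
    case xA : (x \in both) => //=.
    by apply: FG; apply: h; apply: map_f; rewrite mem_enum.
  rewrite /badA !aE; first 1 last.
  + by apply/subsetP => e eA; rewrite !mem_cat eA orbT.
  + by apply/subsetP => e eA; rewrite !mem_cat eA.
  congr (~~ (_ || _))%:R; apply: eq_in_has => e eI; congr (_ && _).
  by apply: FG; rewrite !mem_cat eI !orbT.
- move=> e; rewrite !mem_cat => /or3P[/mapP[x]|/mapP[x]|].
  + by rewrite !mem_enum inE => /andP[h _] ->.
  + by rewrite !mem_enum inE => /andP[_ h] ->.
  by rewrite !mem_enum inE => /andP[].
- rewrite !cat_uniq !map_inj_uniq ?enum_uniq //=; try by move=> x y /set2I.
  rewrite andbT; apply/andP; split; apply/hasPn => e /=.
    rewrite mem_cat => /orP[|] h; apply/negP => /[dup] /AsAt a /AsI b.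
      by rewrite h in a.
    by rewrite h in b.
  by move=> h; apply/negP => /AtI; rewrite h.
- exact: enum_uniq.
rewrite Ex_cat Ex_map; apply: eq_Ex_in => S /subsetP SA.
rewrite Ex_cat Ex_map; apply: eq_Ex_in => T /subsetP TA.
rewrite -(Ex_prod _ _ (enum_uniq _)) -ExZ; apply: eq_Ex_in => J /subsetP JI.
have SA' x : x \in S -> x \in both by move=> /SA; rewrite mem_enum.
have TA' x : x \in T -> x \in both by move=> /TA; rewrite mem_enum.
have nJ a x : ~~ inner a -> [set a; x] \in J = false.
  move=> ia; apply/negP => /JI; rewrite mem_enum inE => /andP[_ /subsetP/(_ a)].
  by rewrite set21 => /(_ isT)/both_inner; apply/negP.
have iS : ~~ inner s by rewrite /inner eqxx.
have iT : ~~ inner t by rewrite /inner eqxx andbF.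
set F := _ :|: _.
have eS : attached s F = S.
  apply/setP => x; rewrite in_set /F !in_setU nJ // orbF.
  apply/andP/idP => [[xA /orP[|]]|xS].
  - by move=> /imsetP[y yS /set2I ->].
  - move=> /imsetP[y yT e]; have := sx_neq_tx (both_inner xA) (both_inner (TA' _ yT)).
    by rewrite e eqxx.
  by split; [exact: SA'|apply/orP; left; apply/imsetP; exists x].
have eT : attached t F = T.
  apply/setP => x; rewrite in_set /F !in_setU nJ // orbF.
  apply/andP/idP => [[xA /orP[|]]|xS].
  - move=> /imsetP[y yT e]; have := sx_neq_tx (both_inner (SA' _ yT)) (both_inner xA).
    by rewrite e eqxx.
  - by move=> /imsetP[y yS /set2I ->].
  by split; [exact: TA'|apply/orP; right; apply/imsetP; exists x].
rewrite /badA eS eT negb_or negbK; case: [disjoint S & T]; rewrite ?mul0r //= mul1r.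
rewrite -prod_negb; apply: eq_big_seq => e eI.
have -> : (e \in F) = (e \in J).
  rewrite /F !in_setU; have [eJ|_] := boolP (e \in J); rewrite ?orbT ?orbF //.
  apply/negP => /orP[] /imsetP[x xS ee].
    have /AsI : e \in As by rewrite ee; apply/mapP; exists x; rewrite ?mem_enum ?SA'.
    by rewrite eI.
  have /AtI : e \in At by rewrite ee; apply/mapP; exists x; rewrite ?mem_enum ?TA'.
  by rewrite eI.
by case: (e \in J) => /=; rewrite ?mul0r ?subr0 // mul1r; case: opposite;
  rewrite ?subrr ?subr0.
Qed.

Lemma inside_ends e : e \in enum inside ->
  [/\ (ends e).1 \in enum both, (ends e).2 \in enum both & (ends e).1 != (ends e).2].
Proof.
rewrite !mem_enum inE => /andP[eE /subsetP eA].
have [ee ne] := endsP (E2 eE); split=> //; apply: eA; rewrite {2}ee.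
  exact: set21.
exact: set22.
Qed.

Definition noA (p : R) := Ex p (enum E) (fun F => (~~ badA F)%:R).

Lemma noA_ge p : 0 <= p <= 1 ->
  (1 - p ^+ 2) ^+ #|both| * gfac p ^+ #|inside| <= noA p.
Proof.
move=> hp; rewrite /noA Ex_badA !cardE; apply: Ex_opposite_ge => //.
- exact: enum_uniq.
- exact: inside_ends.
Qed.

Lemma noA_eq p : 0 <= p <= 1 -> (#|inside| <= 1)%N ->
  noA p = (1 - p ^+ 2) ^+ #|both| * gfac p ^+ #|inside|.
Proof.
move=> hp; rewrite /noA Ex_badA !cardE; have := inside_ends.
case: (enum inside) => [|e [|//]] ie _.
  rewrite expr0 mulr1 -(Ex_opposite0 hp (enum_uniq _)).
  by apply: eq_Ex_in => S _; apply: eq_Ex_in => T _; rewrite big_nil mulr1.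
have [? ? ?] := ie _ (mem_head _ _).
rewrite expr1 -(Ex_opposite1 (x := (ends e).1) (y := (ends e).2) hp (enum_uniq _)) //.
by apply: eq_Ex_in => S _; apply: eq_Ex_in => T _; rewrite big_seq1.
Qed.


Lemma one_near x : x \in onesided ->
  [/\ [set near x; x] \in E, [set far x; x] \notin E,
      ~~ inner (near x), ~~ inner (far x) & near x != far x].
Proof.
rewrite inE /near /far /inner => /andP[_]; case: ifP => sx /=.
  by move=> tx; split=> //; rewrite eqxx ?andbF.
by move=> tx; split; rewrite ?sx ?eqxx ?andbF // eq_sym.
Qed.

Lemma inner_neq a x : ~~ inner a -> inner x -> a != x.
Proof. by move=> ia ix; apply: contraNneq ia => ->. Qed.

(** Conditioning on the link of [x] to its terminal gives the two summands of [phi]. If it survives,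
    each pair of edges through [y] fails with probability 1 - p^2, and Harris' inequality combines
    these failures. *)
Lemma Ex_bad (p : R) x : 0 <= p <= 1 -> x \in onesided ->
  phi p #|star x| <= Ex p (enum E) (fun F => (~~ bad x F)%:R).
Proof.
move=> hp xO; have [nE fE ni fi nf] := one_near xO.
have ix := onesided_inner xO.
pose nx := [set near x; x].
have nxE : nx \in enum E by rewrite mem_enum.
have pr := perm_to_rem nxE.
have ur := enum_uniq (mem E).
rewrite (perm_Ex _ _ ur pr) /=; set r' := rem nx _.
have nx' : nx \notin r' by rewrite mem_rem_uniq // inE eqxx.
rewrite (@eq_Ex_in _ _ _ _ _ (fun=> 1)); last first.
  by move=> F sF; rewrite /bad (negbTE (notin_sub nx' sF)).
rewrite Ex_cst mulr1 /phi lerD2l; have /andP[p0 p1] := hp; apply: ler_wpM2l => //.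
have starE y : y \in star x ->
    [/\ inner y, [set x; y] \in r', [set far x; y] \in r' & [set x; y] != [set far x; y]].
  rewrite inE => /and4P[iy xy fy _]; split=> //.
  - rewrite mem_rem_uniq // inE mem_enum xy andbT; apply/eqP => /eq_set2[[e _]|[_ e]].
      by rewrite -e ix in ni.
    by rewrite -e iy in ni.
  - rewrite mem_rem_uniq // inE mem_enum fy andbT; apply/eqP => /eq_set2[[e _]|[e _]].
      by rewrite e eqxx in nf.
    by rewrite e ix in fi.
  apply/eqP => /eq_set2[[e _]|[_ e]]; first by rewrite -e ix in fi.
  by rewrite -e iy in fi.
pose c y F : R := (~~ (([set x; y] \in F) && ([set far x; y] \in F)))%:R.
rewrite (@eq_Ex_in _ _ _ _ _ (fun F => \prod_(y <- enum (star x)) c y F)); last first.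
  move=> F _; rewrite /bad setU11 /= -prod_negb; apply: eq_big_seq => y.
  rewrite mem_enum => /starE[_ a b _] /=; rewrite !in_setU1.
  have -> : [set x; y] == nx = false by apply: contraNF nx' => /eqP <-.
  by have -> : [set far x; y] == nx = false by apply: contraNF nx' => /eqP <-.
have ur' : uniq r' by rewrite rem_uniq.
apply: le_trans (Harris_prod _ hp _ _).
- rewrite (eq_big_seq (fun=> 1 - p ^+ 2)); last first.
    move=> y; rewrite mem_enum => /starE[_ a b d] /=.
    by rewrite (Ex_pair _ (fun i j => (~~ (i && j))%:R)) //=; ring.
  by rewrite big_const_seq count_predT iter_mulr_1 -cardE.
- by move=> y F _; exact: ler0n.
move=> y _; apply: antitone_negb => F G /subsetP FG /andP[/FG -> /FG ->] //.
Qed.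

Definition unrel (p : R) := Ex p (enum E) (fun F => (~~ short F)%:R).

Lemma unrel_ge (p : R) : 0 <= p <= 1 ->
  (if [set s; t] \in E then 1 - p else 1) *
  ((1 - p ^+ 2) ^+ #|both| * gfac p ^+ #|inside| *
   \prod_(x <- enum onesided) phi p #|star x|) <= unrel p.
Proof.
move=> hp; have /andP[u0 u1] := u_facts hp; have /andP[p0 p1] := hp.
have [g0 _ _] := gfac_weak hp.
pose b0 F : R := ([set s; t] \notin F)%:R.
pose bA F : R := (~~ badA F)%:R.
pose bO F : R := \prod_(x <- enum onesided) (~~ bad x F)%:R.
have aA : antitone bA by apply: antitone_negb => F G; apply: badA_mono.
have aO : antitone bO.
  apply: antitone_prod => [x F _|x _]; first exact: ler0n.
  by apply: antitone_negb => F G; apply: bad_mono.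
have a0 : antitone b0 by apply: antitone_negb => F G /subsetP; apply.
have phi0 j : 0 <= phi p j by apply: le_trans (phi_ge _ hp); apply: bnd_ge0.
(* By [short_cases], failure of all three kinds of event excludes every short path; Harris'
   inequality then separates the three factors. *)
apply: (@le_trans _ _ (Ex p (enum E) (fun F => b0 F * (bA F * bO F)))); last first.
  apply: le_Ex_in => // F sF; rewrite /bO prod_negb /b0 /bA.
  have sF' : F \subset E by apply/subsetP => e /(subsetP sF); rewrite mem_enum.
  have := short_cases sF'; case: (short F) => [/(_ isT)/or3P[]|_] /=.
  - by move=> ->; rewrite mul0r.
  - by move=> ->; rewrite mul0r mulr0.
  - by move=> ->; rewrite !mulr0.
  by rewrite -!natrM ler_nat; case: (_ \notin F); case: (badA F); case: (has _ _).
apply: le_trans (Harris _ hp a0 _); last first.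
  move=> F G FG; apply: ler_pM; rewrite ?ler0n //; last by apply: aO.
  - by rewrite /bO prodr_ge0 // => x _; exact: ler0n.
  by apply: aA.
apply: ler_pM.
- by case: ifP => _; rewrite ?subr_ge0.
- by rewrite !mulr_ge0 ?exprn_ge0 ?prodr_ge0 //; lra.
- rewrite le_eqVlt; apply/orP; left; apply/eqP; case: ifPn => stE.
    have := Ex_notin (f := fun=> 1 : R) p (enum_uniq (mem E)) _ (fun=> erefl).
    move=> /(_ [set s; t]); rewrite mem_enum Ex_cst mulr1 => /(_ stE) <-.
    by apply: eq_Ex_in => F _; rewrite mulr1.
  rewrite -[LHS](Ex_cst p (enum E)); apply: eq_Ex_in => F sF.
  by rewrite /b0 (notin_sub _ sF) // mem_enum.
apply: le_trans (Harris _ hp aA aO).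
apply: ler_pM.
- by rewrite mulr_ge0 ?exprn_ge0 //; lra.
- by rewrite prodr_ge0.
- exact: noA_ge.
apply: le_trans (Harris_prod _ hp _ _).
- rewrite [leLHS]big_seq [leRHS]big_seq; apply: ler_prod => x; rewrite mem_enum => xO.
  by rewrite phi0 Ex_bad.
- by move=> x F _; exact: ler0n.
by move=> x _; apply: antitone_negb => F G; apply: bad_mono.
Qed.

(** Failure forces [st] to be deleted and [badA] to fail. The latter event ignores [st], so the two
    are independent, and [noA_eq] evaluates it exactly. *)
Lemma unrel_le (p : R) : 0 <= p <= 1 -> [set s; t] \in E -> (#|inside| <= 1)%N ->
  unrel p <= (1 - p) * ((1 - p ^+ 2) ^+ #|both| * gfac p ^+ #|inside|).
Proof.
move=> hp stE i1; rewrite -noA_eq // /noA.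
have ia a : ~~ inner a -> a \notin both by apply: contra; exact: both_inner.
have iS : s \notin both by apply: ia; rewrite /inner eqxx.
have iT : t \notin both by apply: ia; rewrite /inner eqxx andbF.
have at_st a F : attached a ([set s; t] |: F) = attached a F.
  apply/setP => x; rewrite in_set [RHS]in_set in_setU1.
  case xA : (x \in both) => //=; case: eqP => // /eq_set2[[_ e]|[_ e]].
    by rewrite -e xA in iT.
  by rewrite -e xA in iS.
rewrite -(@Ex_notin _ _ p (enum E) [set s; t]) ?enum_uniq ?mem_enum //.
  apply: le_Ex_in => // F _; have := @badA_short F.
  rewrite /short; case: (_ \in F) => /=; first by rewrite mul0r.
  by rewrite mul1r; case: (badA F) => [->|_] //=; rewrite ler_nat; case: (_ || _).
move=> F; rewrite /badA !at_st; congr (~~ (_ || _))%:R.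
apply: eq_in_has => e; rewrite mem_enum inE in_setU1 => /andP[_ /subsetP eA].
have -> // : e == [set s; t] = false.
by apply/negP => /eqP ee; move: (eA s); rewrite ee set21 (negbTE iS) => /(_ isT).
Qed.

(** * Counting the edges that can lie on a short path *)

Definition links a := [set x | inner x && ([set a; x] \in E)].
Definition charges := [set xy : V * V | (xy.1 \in onesided) && (xy.2 \in star xy.1)].
Definition useful :=
  [set e in E | e == [set s; t]] :|: [set [set s; x] | x in links s] :|:
  [set [set t; x] | x in links t] :|: inside :|:
  [set [set xy.1; xy.2] | xy in charges].

Lemma useful_sub : useful \subset E.
Proof.
apply/subsetP => e; rewrite !in_setU => /orP[/orP[/orP[/orP[]|]|]|].
- by rewrite inE => /andP[].
- by move=> /imsetP[x]; rewrite inE => /andP[_ +] ->.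
- by move=> /imsetP[x]; rewrite inE => /andP[_ +] ->.
- by rewrite inE => /andP[].
by move=> /imsetP[xy]; rewrite inE => /andP[_ +] ->; rewrite inE => /and4P[].
Qed.

Lemma links_card : (#|links s| + #|links t| = #|both|.*2 + #|onesided|)%N.
Proof.
rewrite -cardsUI.
have -> : links s :&: links t = both.
  apply/setP => x; rewrite !in_set; apply/andP/idP => [[/andP[_ ->] /andP[_ ->]] //|h].
  have /both_inner ix : x \in both by rewrite inE.
  by rewrite ix; case/andP: h => -> ->.
have -> : links s :|: links t = both :|: onesided.
  apply/setP => x; rewrite !in_set.
  case ix : (inner x) => /=; first by do 2![case: (_ \in E)].
  rewrite orbF; apply/esym/negP => h; have /both_inner : x \in both by rewrite inE.
  by rewrite ix.
rewrite (@cardsU_split _ (mem both)) => [|//|x]; first by lia.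
by rewrite !inE; do 2![case: (_ \in E)]; rewrite ?andbF.
Qed.

(** An edge charged to both its ends would have them linked to different terminals, and the last
    clause of [star] then rejects the end linked to [t]. *)
Lemma charges_inj : {in charges &, injective (fun xy : V * V => [set xy.1; xy.2])}.
Proof.
move=> [x y] [x' y']; rewrite !inE /= => /andP[/andP[ix ox] /and4P[iy xy fy ny]].
move=> /andP[/andP[_ oy] /and4P[_ _ fx nx]] /eq_set2[[-> ->] //|[e1 e2]].
exfalso; rewrite -{}e1 -{}e2 in oy fx nx.
move: ox oy fy ny fx nx; rewrite /far /near.
by case sx : ([set s; x] \in E); case sy : ([set s; y] \in E);
   case tx : ([set t; x] \in E); case ty : ([set t; y] \in E); rewrite /= ?sx ?sy ?tx ?ty.
Qed.

Lemma charges_card : #|charges| = (\sum_(x <- enum onesided) #|star x|)%N.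
Proof.
rewrite big_enum /= -sum1_card.
under [RHS]eq_bigr => x _ do rewrite -sum1_card.
by rewrite pair_big_dep /=; apply: eq_bigl => xy; rewrite inE.
Qed.

(** The five families are disjoint. Charged edges avoid both terminals and are not contained in
    [both]; inner edges avoid both terminals; membership of [s] and then of [t] separates the
    rest. *)
Lemma useful_card : #|useful| =
  (([set s; t] \in E) + (#|both|.*2 + #|onesided|) + #|inside| +
   \sum_(x <- enum onesided) #|star x|)%N.
Proof.
have iS : ~~ inner s by rewrite /inner eqxx.
have iT : ~~ inner t by rewrite /inner eqxx andbF.
have nin a x : ~~ inner a -> inner x -> a != x by exact: inner_neq.
have st' : (s == t) = false by apply/negbTE.
have ts' : (t == s) = false by rewrite eq_sym.
have c0 : #|[set e in E | e == [set s; t]]| = ([set s; t] \in E).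
  case stE : (_ \in E); last first.
    by apply: eq_card0 => e; rewrite !inE; case: eqP => [->|]; rewrite ?stE ?andbF.
  rewrite -[RHS](cards1 [set s; t]); apply: eq_card => e; rewrite !inE.
  by case: eqP => [->|]; rewrite ?stE ?andbF.
have cl a : #|[set [set a; x] | x in links a]| = #|links a|.
  by apply: card_imset => x y /set2I.
rewrite /useful.
rewrite (@cardsU_split _ (fun e => [|| s \in e, t \in e | e \subset both])); first last.
- move=> e /imsetP[[x y]]; rewrite inE /= => /andP[xO yS] ->.
  have ix := onesided_inner xO.
  have iy : inner y by move: yS; rewrite inE => /andP[].
  rewrite !inE !(negbTE (nin _ _ _ _)) //=; apply/negP => /subsetP/(_ x).
  rewrite set21 => /(_ isT); move: xO; rewrite !inE.
  by do 2![case: (_ \in E)]; rewrite ?andbF.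
- move=> e; rewrite !in_setU => /orP[/orP[/orP[]|]|].
  + by rewrite inE => /andP[_ /eqP ->]; rewrite set21.
  + by move=> /imsetP[x _ ->]; rewrite set21.
  + by move=> /imsetP[x _ ->]; rewrite set21 orbT.
  by rewrite inE => /andP[_ ->]; rewrite !orbT.
rewrite (@cardsU_split _ (fun e => (s \in e) || (t \in e))); first last.
- move=> e; rewrite inE => /andP[_ /subsetP eA]; rewrite negb_or.
  by apply/andP; split; apply/negP => /eA/both_inner; apply/negP.
- move=> e; rewrite !in_setU => /orP[/orP[]|].
  + by rewrite inE => /andP[_ /eqP ->]; rewrite set21.
  + by move=> /imsetP[x _ ->]; rewrite set21.
  by move=> /imsetP[x _ ->]; rewrite set21 orbT.
rewrite (@cardsU_split _ (fun e => s \in e)); first last.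
- move=> e /imsetP[x]; rewrite inE => /andP[ix _] ->.
  by rewrite !inE st' (negbTE (nin _ _ _ _)).
- move=> e; rewrite !in_setU => /orP[].
  + by rewrite inE => /andP[_ /eqP ->]; rewrite set21.
  by move=> /imsetP[x _ ->]; rewrite set21.
rewrite (@cardsU_split _ (fun e => t \in e)); first last.
- move=> e /imsetP[x]; rewrite inE => /andP[ix _] ->.
  by rewrite !inE ts' (negbTE (nin _ _ _ _)).
- by move=> e; rewrite inE => /andP[_ /eqP ->]; rewrite set22.
rewrite c0 !cl (card_in_imset charges_inj) charges_card -links_card; lia.
Qed.

End Graph.

(** * Equality case *)

Section Core.
Variable R : realFieldType.
Implicit Types (p : R) (a e : nat) (js : seq nat).

Lemma bnd_double p a : bnd p a.*2 = (1 - p ^+ 2) ^+ a.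
Proof. by rewrite /bnd doubleK odd_double expr0 mulr1. Qed.

Lemma bnd1 p : bnd p 1 = gfac p.
Proof. by rewrite /bnd /= expr0 mul1r expr1. Qed.

Lemma bnd0 p : bnd p 0 = 1.
Proof. by rewrite /bnd /= !expr0 mul1r. Qed.

Lemma gfacX_ge p e : 0 <= p <= 1 -> bnd p e <= gfac p ^+ e.
Proof.
move=> hp; have [g0 _ _] := gfac_weak hp.
elim: e => [|e IH]; first by rewrite bnd0 expr0.
apply: le_trans (bndD 1 e hp) _; rewrite exprS bnd1; apply: ler_wpM2l => //; lra.
Qed.

Lemma gfacX_gt p e : 0 < p < 1 -> (1 < e)%N -> bnd p e < gfac p ^+ e.
Proof.
move=> hp; have /andP[p0 p1] := hp; have hp' : 0 <= p <= 1 by rewrite !ltW.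
have [g0 _ _] := gfac_weak hp'.
case: e => [|[|e]] // _; apply: le_lt_trans (bndD 2 e hp') _.
rewrite -[e.+2]/(2 + e)%N exprD; apply: lt_le_trans (_ : bnd p 1 ^+ 2 * bnd p e <= _).
  by rewrite ltr_pM2r ?bnd_gt0 // bnd2.
by rewrite bnd1 ler_wpM2l ?gfacX_ge ?exprn_ge0 //; lra.
Qed.

Lemma prod_phi_ge p js : 0 <= p <= 1 ->
  bnd p (\sum_(j <- js) j.+1) <= \prod_(j <- js) phi p j.
Proof.
move=> hp; elim: js => [|j js IH]; first by rewrite !big_nil bnd0.
rewrite !big_cons; apply: le_trans (bndD _ _ hp) _.
by apply: ler_pM; rewrite ?bnd_ge0 ?phi_ge.
Qed.

Lemma prod_phi_gt p js : 0 < p < 1 -> (0 < size js)%N ->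
  bnd p (\sum_(j <- js) j.+1) < \prod_(j <- js) phi p j.
Proof.
move=> hp; have /andP[p0 p1] := hp; have hp' : 0 <= p <= 1 by rewrite !ltW.
case: js => [//|j js] _; rewrite !big_cons; apply: le_lt_trans (bndD _ _ hp') _.
apply: lt_le_trans (_ : phi p j * bnd p (\sum_(j <- js) j.+1) <= _).
  by rewrite ltr_pM2r ?bnd_gt0 ?phi_gt.
apply: ler_wpM2l (prod_phi_ge _ hp').
exact: le_trans (bnd_ge0 _ hp') (phi_ge _ hp').
Qed.

Lemma core_ge p a e js : 0 <= p <= 1 ->
  bnd p (a.*2 + e + \sum_(j <- js) j.+1) <=
  (1 - p ^+ 2) ^+ a * gfac p ^+ e * \prod_(j <- js) phi p j.
Proof.
move=> hp; rewrite -bnd_double.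
apply: le_trans (bndD _ _ hp) _; apply: ler_pM; rewrite ?bnd_ge0 ?prod_phi_ge //.
by apply: le_trans (bndD _ _ hp) _; apply: ler_pM; rewrite ?bnd_ge0 ?gfacX_ge.
Qed.

Lemma core_gt p a e js : 0 < p < 1 -> (1 < e)%N || (0 < size js)%N ->
  bnd p (a.*2 + e + \sum_(j <- js) j.+1) <
  (1 - p ^+ 2) ^+ a * gfac p ^+ e * \prod_(j <- js) phi p j.
Proof.
move=> hp; have /andP[p0 p1] := hp; have hp' : 0 <= p <= 1 by rewrite !ltW.
have [g0 _ _] := gfac_weak hp'.
rewrite -bnd_double => h; rewrite -addnA; apply: le_lt_trans (bndD _ _ hp') _.
rewrite -mulrA ltr_pM2l ?bnd_gt0 //; apply: le_lt_trans (bndD _ _ hp') _.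
case/orP: h => h.
  apply: lt_le_trans (_ : gfac p ^+ e * bnd p (\sum_(j <- js) j.+1) <= _).
    by rewrite ltr_pM2r ?bnd_gt0 ?gfacX_gt.
  by apply: ler_wpM2l; rewrite ?prod_phi_ge ?exprn_ge0 //; lra.
apply: lt_le_trans (_ : bnd p e * \prod_(j <- js) phi p j <= _).
  by rewrite ltr_pM2l ?bnd_gt0 ?prod_phi_gt.
apply: ler_wpM2r (gfacX_ge _ hp'); exact: le_trans (bnd_ge0 _ hp') (prod_phi_ge _ hp').
Qed.

End Core.

Section Tight.
Variables (R : realFieldType) (V : finType) (s t : V) (E : {set {set V}}).
Hypothesis st : s != t.
Hypothesis E2 : forall e, e \in E -> #|e| = 2%N.

(* The graphs that have only the edge st, paths of length two, and edges
   between the midpoints of these paths. *)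
Definition tight :=
  [/\ [set s; t] \in E, onesided s t E = set0 & E \subset useful s t E].

Definition core (p : R) := (1 - p ^+ 2) ^+ #|both s t E| * gfac p ^+ #|inside s t E| *
   \prod_(x <- enum (onesided s t E)) phi p #|star s t E x|.

(** The witness [z] is the number of edges outside [useful]. They weaken the comparison bound
    without entering [core], so one such edge already makes the inequality strict. *)
Lemma core_bnd (p : R) : exists2 z, (#|E| = ([set s; t] \in E) +
     (#|both s t E|.*2 + #|inside s t E| +
      \sum_(j <- [seq #|star s t E x| | x <- enum (onesided s t E)]) j.+1) + z)%N &
   [/\ 0 <= p <= 1 -> bnd p (#|E| - ([set s; t] \in E)) <= core p,
    0 < p < 1 -> [|| 0 < z, 1 < #|inside s t E| | onesided s t E != set0]%N ->
      bnd p (#|E| - ([set s; t] \in E)) < core p &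
    z = 0%N -> E \subset useful s t E].
Proof.
have us := useful_sub s t E; have cE := subset_leq_card us.
have uc := useful_card st E2.
set js := [seq #|star s t E x| | x <- enum (onesided s t E)].
have sj : (\sum_(j <- js) j.+1 = #|onesided s t E| +
      \sum_(x <- enum (onesided s t E)) #|star s t E x|)%N.
  rewrite big_map cardE -sum1_size -big_split /=; apply: eq_bigr => x _; lia.
have cjs : core p = (1 - p ^+ 2) ^+ #|both s t E| * gfac p ^+ #|inside s t E| *
   \prod_(j <- js) phi p j by rewrite /core /js big_map.
have hE : #|E| = (([set s; t] \in E) +
     (#|both s t E|.*2 + #|inside s t E| + \sum_(j <- js) j.+1) +
     (#|E| - #|useful s t E|))%N.
  rewrite sj -[LHS](subnKC cE) {1}uc; congr addn.
  by rewrite -!addnA; congr addn; congr addn; rewrite addnCA.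
exists (#|E| - #|useful s t E|)%N => //; set z := (#|E| - #|useful s t E|)%N in hE *.
have -> : (#|E| - ([set s; t] \in E) =
   (#|both s t E|.*2 + #|inside s t E| + \sum_(j <- js) j.+1) + z)%N by rewrite {1}hE -addnA addKn.
rewrite cjs; split.
- move=> hp; apply: le_trans (bndD _ _ hp) _.
  apply: le_trans (core_ge _ _ _ hp); rewrite -[leRHS]mulr1.
  by apply: ler_wpM2l; rewrite ?bnd_ge0 ?bnd_le1.
- move=> hp; have /andP[p0 p1] := hp; have hp' : 0 <= p <= 1 by rewrite !ltW.
  move=> h; apply: le_lt_trans (bndD _ _ hp') _.
  have [z0|z0] := ltnP 0 z.
    apply: lt_le_trans (core_ge _ _ _ hp'); rewrite -[ltRHS]mulr1.
    by rewrite ltr_pM2l ?bnd_gt0 ?bnd_lt1.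
  have {}z0 : z = 0%N by apply/eqP; rewrite -leqn0.
  rewrite z0 bnd0 mulr1; apply: core_gt => //.
  case/or3P: h => [|->//|h]; first by rewrite z0.
  by rewrite /js size_map -cardE card_gt0 h orbT.
move=> z0; suff -> : useful s t E = E by [].
by apply/eqP; rewrite eqEcard us; lia.
Qed.

Lemma unrel_lower (p : R) : 0 <= p <= 1 -> (0 < #|E|)%N ->
  (1 - p) * bnd p #|E|.-1 <= unrel s t E p.
Proof.
move=> hp E0; have /andP[p0 p1] := hp; apply: le_trans (unrel_ge st E2 hp).
have [z hz [/(_ hp) h _ _]] := core_bnd p.
rewrite -/(core p); case: ifP h => stE h.
  by apply: ler_wpM2l; rewrite ?subr_ge0 // -subn1.
(* Without [st] all edges count in [bnd], and [bndS] restores the factor 1 - p. *)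
rewrite mul1r; apply: le_trans h; rewrite subn0.
by rewrite -{2}(prednK E0); apply: bndS.
Qed.

(** Each departure (no edge [st], an edge outside [useful], two inner edges, a one-sided vertex)
    makes some step strict. What remains is one inner edge at most, so parity of the edge count
    fixes both cardinals. *)
Lemma unrel_rigid (p : R) : 0 < p < 1 -> (0 < #|E|)%N ->
  unrel s t E p <= (1 - p) * bnd p #|E|.-1 ->
  [/\ tight, #|inside s t E| = odd #|E|.-1 & #|both s t E| = #|E|.-1./2].
Proof.
move=> hp E0; have /andP[p0 p1] := hp; have hp' : 0 <= p <= 1 by rewrite !ltW.
move=> /(le_trans (unrel_ge st E2 hp')).
have [z hz [/(_ hp') h /(_ hp) hs hu]] := core_bnd p.
rewrite -/(core p); case: ifP h hs hz => stE h hs hz; last first.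
  rewrite mul1r leNgt => /negP[]; apply: lt_le_trans h; rewrite subn0.
  by rewrite -{2}(prednK E0); apply: bndS_lt.
rewrite ler_pM2l ?subr_gt0 // leNgt -subn1 => /negP nl.
have [z0|z0] := ltnP 0 z; first by case: nl; apply: hs; rewrite z0.
have [i1|i1] := ltnP 1 #|inside s t E|; first by case: nl; apply: hs; rewrite i1 orbT.
have [o0|o0] := eqVneq (onesided s t E) set0; last first.
  by case: nl; apply: hs; rewrite o0 !orbT.
have {}z0 : z = 0%N by apply/eqP; rewrite -leqn0.
have {}hz : (#|E| - 1 = #|both s t E|.*2 + #|inside s t E|)%N.
  by move: hz; rewrite o0 enum_set0 /= big_nil z0 !addn0 => ->; rewrite (addKn 1).
rewrite hz; split; [by split=> //; apply: hu| |].
  by rewrite oddD odd_double; case: #|inside s t E| i1 => [|[]].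
by rewrite halfD odd_double doubleK; case: #|inside s t E| i1 => [|[]] //=; rewrite addn0.
Qed.

Lemma unrel_tight (p : R) : 0 <= p <= 1 -> tight -> (#|inside s t E| <= 1)%N ->
  unrel s t E p <= (1 - p) * bnd p #|E|.-1.
Proof.
move=> hp [stE o0 us] i1; apply: le_trans (unrel_le st E2 hp stE i1) _.
have cE : #|E| = #|useful s t E|.
  by apply/eqP; rewrite eqn_leq !subset_leq_card ?useful_sub.
have := useful_card st E2; rewrite -cE stE o0 cards0 enum_set0 big_nil => ->.
rewrite (_ : _.-1 = #|both s t E|.*2 + #|inside s t E|)%N; last by lia.
apply: ler_wpM2l; first by have /andP[_] := hp; rewrite subr_ge0.
rewrite -bnd_double /bnd halfD oddD !odd_double doubleK /=.
by case: #|inside s t E| i1 => [|[|//]] _; rewrite /= ?addn0 ?expr0 ?mulr1.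
Qed.
End Tight.

(** * Tight graphs with equal counts are isomorphic *)

Section Isomorphism.
Variable V : finType.

(** Membership in the middle block is read off the position, so a position-preserving map respects
    the blocks. *)
Lemma mem_index_cat (p q r : seq V) v :
  uniq (p ++ q ++ r) -> v \in p ++ q ++ r ->
  (v \in q) = (size p <= index v (p ++ q ++ r) < size p + size q)%N.
Proof.
rewrite !cat_uniq has_cat negb_or => /and3P[_ /andP[/hasPn qp _] _].
rewrite !mem_cat !index_cat; have [vp _|vp /=] := boolP (v \in p).
  have -> : (v \in q) = false by apply/negP => /qp; rewrite /= vp.
  by have := index_mem v p; rewrite vp ltnNge => /negbTE ->.
rewrite leq_addr ltn_add2l /=; case: ifP => vq _; first by rewrite index_mem vq.
by rewrite ltnNge leq_addr.
Qed.

Lemma tight_edges (s t : V) (E : {set {set V}}) (u v : V) : tight s t E ->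
  ([set u; v] \in E) =
  [|| [set u; v] == [set s; t],
      (u \in [set s; t]) && (v \in both s t E),
      (v \in [set s; t]) && (u \in both s t E) |
      [set u; v] \in inside s t E].
Proof.
move=> [stE o0 /subsetP us]; apply/idP/or4P; last first.
  have h a x : a \in [set s; t] -> x \in both s t E -> [set a; x] \in E.
    by rewrite !inE => /orP[] /eqP -> /andP[].
  case=> [/eqP->//|/andP[]|/andP[ust vA]|]; [exact: h|by rewrite setUC h|].
  by rewrite inE => /andP[].
move=> /us.
have links_both a x : a \in [set s; t] -> x \in links s t E a -> x \in both s t E.
  rewrite !inE => hst /andP[ix ax]; have : x \notin onesided s t E by rewrite o0 inE.
  rewrite inE ix /=; case/orP: hst ax => /eqP -> ->; rewrite /=.
    by rewrite negbK.
  by rewrite addbT negbK => ->.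
have st1 : s \in [set s; t] by rewrite set21.
have st2 : t \in [set s; t] by rewrite set22.
case/setUP => [/setUP[/setUP[/setUP[]|]|]|].
- by rewrite in_set => /andP[_ h]; apply: Or41.
- move=> /imsetP[x xl /eq_set2[[-> ->]|[-> ->]]].
    by apply: Or42; rewrite st1 (links_both s).
  by apply: Or43; rewrite st1 (links_both s).
- move=> /imsetP[x xl /eq_set2[[-> ->]|[-> ->]]].
    by apply: Or42; rewrite st2 (links_both t).
  by apply: Or43; rewrite st2 (links_both t).
- exact: Or44.
by move=> /imsetP[xy]; rewrite in_set o0 in_set0.
Qed.

(** The vertices are listed as terminals, common neighbours, then the rest. The ends of an inner
    edge, if there is one, come first among the common neighbours. *)
Lemma tight_layout (s t : V) (E : {set {set V}}) :
  s != t -> (forall e, e \in E -> #|e| = 2%N) -> (#|inside s t E| <= 1)%N ->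
  exists lA lR, [/\ uniq ([:: s; t] ++ lA ++ lR),
    (forall x, x \in [:: s; t] ++ lA ++ lR), lA =i both s t E &
    inside s t E = if #|inside s t E| == 1%N
                   then [set [set nth s lA 0; nth s lA 1]] else set0].
Proof.
move=> st E2 i1.
have sA : s \notin both s t E.
  by apply/negP => /(both_inner E2); rewrite /inner eqxx.
have tA : t \notin both s t E.
  by apply/negP => /(both_inner E2); rewrite /inner eqxx andbF.
suff [lA [uA eA iA]] : exists lA, [/\ uniq lA, lA =i both s t E &
    inside s t E = if #|inside s t E| == 1%N
                   then [set [set nth s lA 0; nth s lA 1]] else set0].
  exists lA, (enum (~: ([set s; t] :|: both s t E))); split=> //.
    rewrite cat_uniq cat_uniq uA enum_uniq has_cat negb_or /= inE st /= !andbT.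
    apply/andP; split; last first.
      by apply/hasPn => x; rewrite mem_enum in_setC in_setU negb_or /= eA => /andP[_].
    apply/andP; split; apply/hasPn => x.
      rewrite eA => xA; rewrite /= in_cons mem_seq1; apply/negP => /orP[] /eqP e.
        by rewrite e (negbTE sA) in xA.
      by rewrite e (negbTE tA) in xA.
    by rewrite mem_enum in_setC in_setU negb_or /= !inE => /andP[].
  move=> x; rewrite !mem_cat mem_enum eA in_setC in_setU in_set2 !inE.
  by case: (x == s); case: (x == t); case: (_ && _).
case: (#|inside s t E| =P 1%N) => [/eqP/cards1P[e ie]|ni]; last first.
  exists (enum (both s t E)); split; [exact: enum_uniq|by move=> x; rewrite mem_enum|].
  by apply: cards0_eq; case: #|_| i1 ni => [|[]].
have ee : e \in enum (inside s t E) by rewrite ie mem_enum set11.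
have [xA yA xy] := inside_ends E2 ee.
have eE : e \in E by move: ee; rewrite mem_enum inE => /andP[].
have [ed _] := endsP s (E2 e eE).
set x := (ends s e).1 in xA xy ed; set y := (ends s e).2 in yA xy ed.
exists (x :: y :: rem y (rem x (enum (both s t E)))).
have pr : perm_eq (enum (both s t E)) (x :: y :: rem y (rem x (enum (both s t E)))).
  rewrite (permPl (perm_to_rem xA)) perm_cons; apply: perm_to_rem.
  by rewrite mem_rem_uniq ?enum_uniq // inE eq_sym xy.
split; [by rewrite -(perm_uniq pr) enum_uniq| |by rewrite /= -ed].
by move=> z; rewrite -(perm_mem pr) mem_enum.
Qed.

(** The two layouts are matched position by position. By [tight_edges], adjacency is determined by
    the blocks and the inner edge, both of which this matching preserves. *)
Lemma tight_iso (s t s' t' : V) (E E' : {set {set V}}) :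
  s != t -> (forall e, e \in E -> #|e| = 2%N) -> tight s t E ->
  s' != t' -> (forall e, e \in E' -> #|e| = 2%N) -> tight s' t' E' ->
  (#|inside s t E| <= 1)%N -> #|inside s t E| = #|inside s' t' E'| ->
  #|both s t E| = #|both s' t' E'| ->
  exists sigma : {perm V},
    (forall u v, ([set u; v] \in E) = ([set sigma u; sigma v] \in E')) /\
    [set sigma s; sigma t] = [set s'; t'].
Proof.
move=> st E2 tE st' E2' tE' i1 ii bb.
have [lA [lR [ul cl eA iA]]] := tight_layout st E2 i1.
have i1' : (#|inside s' t' E'| <= 1)%N by rewrite -ii.
have [lA' [lR' [ul' cl' eA' iA']]] := tight_layout st' E2' i1'.
have szA : size lA = size lA'.
  move: ul ul'; rewrite !cat_uniq => /and3P[_ _ /and3P[uA _ _]] /and3P[_ _ /and3P[uA' _ _]].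
  by rewrite -(card_uniqP uA) -(card_uniqP uA') (eq_card eA) (eq_card eA').
set l := [:: s; t] ++ lA ++ lR in ul cl; set l' := [:: s'; t'] ++ lA' ++ lR' in ul' cl'.
have szl : size l = size l'.
  by rewrite -(card_uniqP ul) -(card_uniqP ul'); apply: eq_card => x; rewrite cl cl'.
pose f v := nth s' l' (index v l).
have il v : (index v l < size l')%N by rewrite -szl index_mem.
have fI : injective f.
  move=> u v /eqP; rewrite /f nth_uniq // => /eqP h.
  by rewrite -(nth_index s (cl u)) h nth_index.
have fidx v : index (f v) l' = index v l by rewrite /f index_uniq.
exists (perm fI).
have fA v : (f v \in both s' t' E') = (v \in both s t E).
  by rewrite -eA -eA' (mem_index_cat ul') // (mem_index_cat ul) // -/l -/l' fidx szA.
have fs : f s = s' by rewrite /f /= eqxx.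
have ft : f t = t' by rewrite /f /= (negbTE st) eqxx.
have fst v : (f v \in [set s'; t']) = (v \in [set s; t]).
  by rewrite !inE -{1}fs -{1}ft !(inj_eq fI).
have f2 u v : [set f u; f v] = f @: [set u; v] by rewrite imsetU1 imset_set1.
split; last by rewrite !permE fs ft.
move=> u v; rewrite !permE (tight_edges _ _ tE) (tight_edges _ _ tE') !fA !fst.
rewrite -{1}fs -{1}ft !f2 (inj_eq (imset_inj fI)); congr [|| _, _, _ | _].
rewrite iA iA' -ii; case: eqP => [c1|_]; last by rewrite !inE.
(* The inner edge has two ends in [both], so positions 0 and 1 of [lA] are genuine and not the
   default of [nth]. *)
have szA2 : (1 < size lA)%N.
  have : [set nth s lA 0; nth s lA 1] \in inside s t E by rewrite iA c1 eqxx set11.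
  rewrite inE => /andP[/E2 e2 /subset_leq_card]; rewrite e2 -(eq_card eA).
  by rewrite (card_uniqP _) //; move: ul; rewrite !cat_uniq => /and3P[_ _ /andP[]].
have fn i : (i < size lA)%N -> f (nth s lA i) = nth s' lA' i.
  move=> ilA; have il2 : (2 + i < size l)%N by rewrite /l /= size_cat !ltnS ltn_addr.
  have e1 : nth s l (2 + i) = nth s lA i by rewrite -[LHS]/(nth s (lA ++ lR) i) nth_cat ilA.
  rewrite -e1 /f index_uniq //.
  by rewrite -[LHS]/(nth s' (lA' ++ lR') i) nth_cat -szA ilA.
rewrite !inE -(fn 0) ?(ltnW szA2) // -(fn 1%N) // f2 (inj_eq (imset_inj fI)) //.
Qed.

End Isomorphism.

(** * The extremal graph *)

Lemma dpathset3 n (s t : 'I_n) (F : {set {set 'I_n}}) :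
  s != t -> dpathset 3 s t F <-> short s t F.
Proof.
move=> st; split.
  case=> [[|x [|y [|z [|w p]]]]] [] //=.
  - by move=> _ e; rewrite e eqxx in st.
  - by move=> _ -> _ /andP[h _]; rewrite /short h.
  - rewrite !inE !negb_or => /and3P[/andP[sx _] xt _] yt _ /and3P[h1 h2 _].
    rewrite yt in xt h2; apply/or3P/Or32/existsP; exists x.
    by rewrite /inner eq_sym sx xt h1 setUC h2.
  rewrite !inE !negb_or => /and4P[/and3P[sx sy _] /andP[xy xz] yz _] zt _.
  move=> /and4P[h1 h2 h3 _]; rewrite zt in xz yz h3.
  apply/or3P/Or33/existsP; exists x; apply/existsP; exists y.
  by rewrite /inner ![_ == s]eq_sym sx sy xz yz xy h1 h2 setUC h3.
rewrite /short => /or3P[h|/existsP[x /and3P[/andP[xs xt] h1 h2]]|].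
- by exists [:: t]; split; rewrite //= ?inE ?st ?h.
- by exists [:: x; t]; split; rewrite //= ?inE ?negb_or 1?eq_sym ?xs ?xt ?st // h1 setUC h2.
move=> /existsP[x /existsP[y /and5P[/andP[xs xt] /andP[ys yt] xy h1 /andP[h2 h3]]]].
exists [:: x; y; t]; split=> //=; last by rewrite h1 h2 setUC h3.
by rewrite !inE !negb_or ![s == _]eq_sym xs ys xy xt yt eq_sym st.
Qed.

Lemma ttg_wfP n (G : ttg n) : ttg_wf G ->
  tsrc G != tdst G /\ forall e, e \in tedges G -> #|e| = 2%N.
Proof.
by case/andP=> st /forallP h; split=> // e eE; have := h e; rewrite eE => /eqP.
Qed.

(** An edge is kept with probability [1 - rho], which is the parameter of [Ex]. *)
Lemma reliab_unrel (R : realType) n (G : ttg n) (rho : R) : tsrc G != tdst G ->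
  reliab 3 G rho = 1 - unrel (tsrc G) (tdst G) (tedges G) (1 - rho).
Proof.
case: G => E s t /= st.
have uE := enum_uniq (mem E).
have -> : 1 - unrel s t E (1 - rho) =
    Ex (1 - rho) (enum E) (fun F => (short s t F)%:R).
  rewrite /unrel -[X in X - _](Ex_cst (1 - rho) (enum E)) -mulN1r -ExZ -ExD.
  by apply: eq_Ex_in => F _; case: short; rewrite /= ?mulr0 ?mulr1 ?addr0 ?subrr.
rewrite Ex_sum // /reliab /=.
have -> : [set x in enum E] = E by apply/setP => x; rewrite inE mem_enum.
rewrite big_mkcondr /=; apply: eq_bigr => F _; rewrite subKr -cardE.
have -> : `[< dpathset 3 s t F >] = short s t F.
  by apply/asboolP/idP => /(dpathset3 F st).
by case: short; rewrite ?mulr1 ?mulr0.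
Qed.

Lemma H_sizes n m : (5 <= m)%N -> (m <= 2 * n - 3)%N ->
  [/\ (4 <= H_k m)%N, (H_k m <= n)%N, (H_r m <= 1)%N &
      m = ((H_k m - 2).*2 + 1 + H_r m)%N].
Proof.
move=> m5 mn; rewrite /H_k /H_r; have := odd_double_half m; case: (odd m) => hm.
  have -> : (m + 3)./2 = (m./2 + 2)%N by lia.
  by split; lia.
have -> : (m + 2)./2 = (m./2 + 1)%N by lia.
by split; lia.
Qed.

Section H.
Variables (n m : nat) (s t : 'I_n).
Hypotheses (m5 : (5 <= m)%N) (mn : (m <= 2 * n - 3)%N).
Hypotheses (hs : nat_of_ord s = 0%N) (ht : nat_of_ord t = 1%N).

Let k := H_k m.
Let r := H_r m.
Let E := H_edges n m.

Lemma H_st : s != t.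
Proof. by apply/eqP => e; move: hs ht; rewrite e => ->. Qed.

Lemma H_mem (u v : 'I_n) : ([set u; v] \in E) = A_adj k r u v || A_adj k r v u.
Proof.
rewrite inE; apply/existsP/idP => [[u' /existsP[v' /andP[/eqP e]]]|h].
  by case: (eq_set2 e) => -[-> ->]; rewrite // orbC.
by exists u; apply/existsP; exists v; rewrite eqxx.
Qed.

Lemma H_edge (e : {set 'I_n}) : e \in E -> exists u v : 'I_n, e = [set u; v] /\ A_adj k r u v.
Proof.
rewrite inE => /existsP[u /existsP[v /andP[/eqP -> /orP[]]]] h; first by exists u, v.
by exists v, u; rewrite setUC.
Qed.

Lemma H_card2 (e : {set 'I_n}) : e \in E -> #|e| = 2%N.
Proof.
move=> /H_edge[u [v [-> h]]]; rewrite cards2; suff -> : u != v by [].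
by apply/eqP => uv; move: h; rewrite uv /A_adj; have [k4 _ _ _] := H_sizes m5 mn; lia.
Qed.

Lemma H_inner (x : 'I_n) : inner s t x = (2 <= x)%N.
Proof. by rewrite /inner -!val_eqE /= hs ht; lia. Qed.

Lemma H_s (x : 'I_n) : (2 <= x)%N -> ([set s; x] \in E) = (x < k)%N.
Proof. by move=> x2; rewrite H_mem hs /A_adj; lia. Qed.

Lemma H_t (x : 'I_n) : (2 <= x)%N -> ([set t; x] \in E) = (x < k)%N.
Proof. by move=> x2; rewrite H_mem ht /A_adj; lia. Qed.

Lemma H_both (x : 'I_n) : (x \in both s t E) = (2 <= x < k)%N.
Proof.
apply/idP/idP => [xA|/andP[x2 xk]]; last by rewrite inE H_s // H_t // xk.
have := both_inner H_card2 xA; rewrite H_inner => x2.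
by move: xA; rewrite inE H_s // => /andP[-> _]; rewrite x2.
Qed.

Lemma H_tight : tight s t E.
Proof.
have [k4 kn r1 _] := H_sizes m5 mn.
split.
- by rewrite H_mem hs ht.
- apply/setP => x; rewrite in_set in_set0 H_inner; case: leqP => //= x2.
  by rewrite H_s // H_t // addbb.
apply/subsetP => e eE; have [u [v [ee h]]] := H_edge eE.
have ord_eq (a b : 'I_n) : nat_of_ord a = b -> a = b by exact: val_inj.
case/or4P: h => [/andP[/eqP u0 /eqP v1]|/andP[/eqP u0 v2]|/andP[/eqP u1 v2]|/andP[/eqP u2 v3]].
- have us : u = s by apply: ord_eq; rewrite u0.
  have vt : v = t by apply: ord_eq; rewrite v1.
  by rewrite !in_setU in_set eE ee us vt eqxx.
- have us : u = s by apply: ord_eq; rewrite u0.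
  rewrite !in_setU; do 3![apply/orP; left]; apply/orP; right.
  apply/imsetP; exists v; last by rewrite ee us.
  by case/andP: v2 => v2 vk; rewrite inE H_inner H_s // v2 vk.
- have us : u = t by apply: ord_eq; rewrite u1.
  rewrite !in_setU; do 2![apply/orP; left]; apply/orP; right.
  apply/imsetP; exists v; last by rewrite ee us.
  by case/andP: v2 => v2 vk; rewrite inE H_inner H_t // v2 vk.
rewrite !in_setU; apply/orP; left; apply/orP; right; rewrite inE eE ee.
by apply/subsetP => x; rewrite !in_set2 H_both => /orP[] /eqP ->; lia.
Qed.

Lemma H_inside_card : #|inside s t E| = r.
Proof.
have [k4 kn r1 _] := H_sizes m5 mn.
have n2 : (2 < n)%N by lia.
have n3 : (3 < n)%N by lia.
pose e := [set Ordinal n2; Ordinal n3].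
have iP f : (f \in inside s t E) = (f == e) && (r == 1%N).
  apply/idP/idP => [|/andP[/eqP -> /eqP r1']].
    rewrite inE => /andP[fE /subsetP fA]; have [u [v [ff h]]] := H_edge fE.
    have := fA u; have := fA v; rewrite ff set21 set22 !H_both => /(_ isT) hv /(_ isT) hu.
    have {h} [u2 v3 r1'] : [/\ nat_of_ord u = 2%N, nat_of_ord v = 3%N & r = 1%N].
      by move: h; rewrite /A_adj => h; split; lia.
    (* The only possible inner edge joins the vertices labelled 2 and 3. *)
    rewrite r1' andbT /e; apply/eqP; congr [set _; _]; exact: val_inj.
  rewrite inE H_mem /A_adj /= r1' /=; apply/subsetP => x; rewrite !in_set2 H_both.
  by move=> /orP[] /eqP -> /=; lia.
case: (r =P 1%N) => [r1'|r0].
  rewrite r1' -[RHS](cards1 e); apply: eq_card => f.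
  by rewrite iP r1' andbT !inE.
have -> : r = 0%N by lia.
by apply: eq_card0 => f; rewrite iP (introF eqP r0) andbF.
Qed.

Lemma H_both_card : #|both s t E| = (k - 2)%N.
Proof.
have [k4 kn r1 _] := H_sizes m5 mn.
have b (i : 'I_(k - 2)) : (i + 2 < n)%N by have := ltn_ord i; lia.
have fi : injective (fun i => Ordinal (b i)).
  by move=> i j /(congr1 val) /= h; apply: val_inj => /=; lia.
rewrite -[RHS]card_ord -(card_imset _ fi); apply: eq_card => x.
rewrite H_both; apply/andP/imsetP => [[x2 xk]|[i _ ->]]; last first.
  by have := ltn_ord i; split=> /=; lia.
have xk' : (x - 2 < k - 2)%N by lia.
by exists (Ordinal xk') => //; apply: val_inj => /=; lia.
Qed.

Lemma H_card : #|E| = m.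
Proof.
have [_ _ _ ->] := H_sizes m5 mn; have [stE o0 us] := H_tight.
have -> : #|E| = #|useful s t E|.
  by apply/eqP; rewrite eqn_leq !subset_leq_card ?useful_sub.
rewrite (useful_card H_st H_card2) stE o0 cards0 enum_set0 big_nil.
by rewrite H_both_card H_inside_card; lia.
Qed.

Lemma H_in_T : in_T m (H_graph m s t).
Proof.
rewrite /in_T /ttg_wf /= H_st H_card eqxx andbT /=.
by apply/forallP => e; apply/implyP => /H_card2 ->.
Qed.

End H.

(* Optimality and uniqueness *)
Local Close Scope ring_scope.

Theorem theorem3 (R : realType) (n m : nat) (s t : 'I_n) :
  6 <= n -> 5 <= m -> m <= 2 * n - 3 ->
  nat_of_ord s = 0 -> nat_of_ord t = 1 ->
  UMRTTG R 3 m (H_graph m s t) /\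
  (forall G : ttg n, UMRTTG R 3 m G -> ttg_iso G (H_graph m s t)).
Proof.
move=> n6 m5 mn hs ht.
have HT := H_in_T m5 mn hs ht.
have tH := H_tight m5 mn hs ht; have sH := H_st hs ht.
have E2H := H_card2 m5 mn hs ht; have cH := H_card m5 mn hs ht.
have iH := H_inside_card m5 mn hs ht.
have [k4 kn r1 em] := H_sizes m5 mn.
have em' : m.-1 = (H_k m - 2).*2 + H_r m by rewrite {1}em addn1.
have m0 : 0 < m by apply: leq_trans m5.
have uH (p : R) : (0 <= p <= 1)%R ->
    (unrel s t (H_edges n m) p <= (1 - p) * bnd p m.-1)%R.
  by move=> hp; rewrite -{2}cH; apply: unrel_tight => //; rewrite iH.
split.
  split=> // G /andP[/ttg_wfP[st E2] /eqP cG] rho /andP[rho0 rho1].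
  rewrite (reliab_unrel _ st) (@reliab_unrel _ _ (H_graph m s t) _ sH) lerD2l lerN2.
  have hp : (0 <= 1 - rho <= 1)%R by apply/andP; split; lra.
  apply: le_trans (uH _ hp) _; have := unrel_lower st E2 hp.
  by rewrite cG; apply.
move=> G [/andP[/ttg_wfP[st E2] /eqP cG] optG].
(* A value strictly between 0 and 1, where the strict estimates apply. *)
pose rho : R := (2^-1)%R.
have hrho : (0 <= rho <= 1)%R by apply/andP; rewrite /rho; split; lra.
have hp : (0 < 1 - rho < 1)%R by apply/andP; rewrite /rho; split; lra.
have hp' : (0 <= 1 - rho <= 1)%R by apply/andP; rewrite /rho; split; lra.
have := optG _ HT _ hrho.
rewrite (reliab_unrel _ st) (@reliab_unrel _ _ (H_graph m s t) _ sH) lerD2l lerN2.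
(* Optimality puts the unreliability of [G] below that of the extremal graph, hence below the common
   bound, and rigidity applies. *)
move=> h; have {h} := le_trans h (uH _ hp').
have := unrel_rigid st E2 hp; rewrite cG => rigid /(rigid m0)[tG iG bG].
apply: (tight_iso st E2 tG sH E2H tH).
- by rewrite iG; case: odd.
- by rewrite iG iH em' oddD odd_double; case: H_r r1 => [|[]].
rewrite bG (H_both_card m5 mn hs ht) em' halfD odd_double doubleK.
by case: H_r r1 => [|[]] //= _; rewrite addn0.
Qed.
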